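(* Consider the universal search-and-stop test described in the context, with fixed parameters $\rho_1>1$, $\rho_2>1$, $b>0$ and inner threshold $a$. For any $0<\nu<1$ and for $b>0$ chosen sufficiently small, as $a\to\infty$ the test yields a vanishing error probability $P_{\max}\to 0$ and also satisfies $$\mathbb{E}_i[N]=\mathbb{E}_i\left[\sum_{t=1}^{\tau}c(i,U_t)\right]\ \le\ \frac{-\log P_{\max}}{\nu\,D(\mu\|\pi)}\,(1+o(1)),\qquad i=1,\ldots,M,$$ universally for every $\mu\neq\pi$ (where $\mu$ is a full-support probability mass function on $\mathcal{Y}$; the test uses only $\pi$ and not $\mu$).
   Context: All logarithms are natural; $[M]=\{1,\ldots,M\}$; $D(p\|q)=\sum_y p(y)\log\frac{p(y)}{q(y)}$ is relative entropy. **Model.** $\mathcal{Y}$ is a finite set; $\mu$ (target distribution) and $\pi$ (absence distribution) are pmfs on $\mathcal{Y}$ with full support, $\mu\ne\pi$. There are $M$ locations. Under hypothesis $i\in[M]$ the target is at location $i$: an observation taken when searching location $u$ is, conditionally on all past observations and past search locations, distributed as $\mu$ if $u=i$ and as $\pi$ if $u\ne i$. Under hypothesis $0$ (missing target) every observation is distributed as $\pi$. $\mathbb{P}_i,\mathbb{E}_i$ denote probability and expectation under hypothesis $i$. **Inner binary test at a location.** For $a>1$, take successive fresh observations $Y_1,Y_2,\ldots$ at one location, let $\gamma^{(n)}$ be the empirical distribution of $(Y_1,\ldots,Y_n)$, and let $$\tilde N^b=\min\{n\ge1:\ nD(\gamma^{(n)}\|\pi)>\log a+n^{2/3}+|\mathcal{Y}|\log(n+1)\},$$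 $$N^b=\min(\tilde N^b,\lfloor a(\log a)^{\rho_1}\rfloor).$$ The inner test stops at $N^b$ and outputs $1$ (''target is there'') if $\tilde N^b\le a(\log a)^{\rho_1}$ and $0$ otherwise. Let $c_a$ and $\kappa_a$ be the expectations of $N^b$ when the observations are i.i.d. $\mu$, respectively i.i.d. $\pi$. Define the cost $c(i,u)=c_a$ if $u=i\in[M]$, $c(i,u)=\kappa_a$ if $i\in[M]$, $u\neq i$, and $c(0,u)=\kappa_a$ for all $u\in[M]$. **Outer test.** At each (outer) time $t=1,2,\ldots$ a location $U_t\in[M]$ is chosen, the inner test is run there with $N^b_t$ fresh observations, producing the binary output $Z_t$. Let $N(i,1)$ and $N(i,0)$ be the numbers of times so far that location $i$ was searched with output $1$ and $0$, respectively. The estimate based on the outcomes so far is $$\hat i=\begin{cases}\operatorname{argmax}_{i\in[M]}\,(N(i,1)-N(i,0)) & \text{if }\max_{i\in[M]}(N(i,1)-N(i,0))>0,\\ 0&\text{otherwise}\end{cases}$$ (ties in the argmax broken by an arbitrary fixed deterministic rule). *Search policy.* At time $t$, with $\hat i$ computed from the outcomes at times $1,\ldots,t-1$: if $t=\lfloor e^{bk}\rfloor$ for some $k\in\{0,1,\ldots\}$, then $U_t=(k\bmod M)+1$ independently of $\hat i$ (if several $k$ give the same $t$, one is chosen by an arbitrary fixed rule); at all other times, $U_t=\hat i$ if $\hat i\ne0$, and if $\hat i=0$, $U_t=(i_{t'}\bmod M)+1$ where $i_{t'}$ is the location searched at the last time $t'<t$ at which the estimate was $0$. *Mismatched model.*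 Let $\overline\mu_b,\overline\pi_b$ be pmfs on $\{0,1\}$ with $\overline\mu_b(0)=1-\overline\mu_b(1)=\overline\pi_b(1)=1-\overline\pi_b(0)=\frac1a$. For $i\in[M]$ let $\overline p_i^u=\overline\mu_b$ if $u=i$ and $\overline p_i^u=\overline\pi_b$ if $u\ne i$; let $\overline p_0^u=\overline\pi_b$ for all $u\in[M]$. Since the policy is deterministic given past outcomes, set $\overline p_i(z^t)=\prod_{k=1}^t\overline p_i^{u_k}(z_k)$. *Stopping and decision.* With $\hat i$ computed from the outcomes $z^t$ up to time $t$, $\tau$ is the first $t$ such that $$\min_{j\in\{0,\ldots,M\},\,j\ne\hat i}\ \frac{\overline p_{\hat i}(z^t)}{\overline p_j(z^t)}>e^{a^{\rho_2}(\log a)^{\rho_1}},$$ and the final decision is $\delta(z^\tau)=\hat i$. **Performance measures.** $N=\sum_{t=1}^\tau N^b_t$ is the total number of $\mathcal{Y}$-valued observations, and $P_{\max}=\max_{i=0,\ldots,M}\mathbb{P}_i[\delta(Z^\tau)\ne i]$. The $o(1)$ is as $a\to\infty$. *)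

(* Defs.v *)
From mathcomp Require Import all_boot all_order all_algebra.
From mathcomp Require Import all_classical all_reals all_analysis.

Set Implicit Arguments.
Unset Strict Implicit.
Unset Printing Implicit Defensive.

Import Order.TTheory GRing.Theory Num.Theory.
Import numFieldNormedType.Exports.

Local Open Scope classical_set_scope.
Local Open Scope ring_scope.

(* Conventions.  Locations are 'I_M, the element u standing for location u + 1.
   Hypotheses are option 'I_M: Some u means that the target is at u, None is
   the missing-target hypothesis 0.  Inner outputs are booleans (true for 1).
   The index t of an outer step and the index n of an observation within a step
   start at 0, i.e. they stand for the (t + 1)-st and the (n + 1)-st. *)

(* The least n satisfying p; None encodes +oo. *)
Definition first_time (p : pred nat) : option nat :=
  if pselect (exists n, p n) is left ex_p then Some (ex_minn ex_p) else None.

(* t < tau *)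
Definition before (tau : option nat) (t : nat) : bool :=
  if tau is Some n then (t < n)%N else true.

Section FiniteDistributions.
Variables (R : realType) (Y : finType).

Definition full_pmf (p : {ffun Y -> R}) : Prop :=
  (forall y, 0 < p y) /\ \sum_y p y = 1.

(* Terms with p y = 0 vanish. *)
Definition relent (p q : {ffun Y -> R}) : R := \sum_y p y * ln (p y / q y).

Definition empirical (n : nat) (ys : nat -> Y) : {ffun Y -> R} :=
  [ffun y => (count_mem y (mkseq ys n))%:R / n%:R].

End FiniteDistributions.

Section InnerTest.
Variables (R : realType) (Y : finType) (pi : {ffun Y -> R}) (rho1 a : R).

Definition inner_crossing (ys : nat -> Y) (n : nat) : bool :=
  ln a + n%:R `^ (2 / 3) + #|Y|%:R * ln (n%:R + 1)
    < n%:R * relent (empirical R n ys) pi.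

Definition inner_horizon : R := a * ln a `^ rho1.

(* \tilde N^b *)
Definition inner_hit (ys : nat -> Y) : option nat :=
  first_time (fun n => (1 <= n)%N && inner_crossing ys n).

(* N^b *)
Definition inner_length (ys : nat -> Y) : nat :=
  let L := Num.truncn inner_horizon in
  if inner_hit ys is Some n then minn n L else L.

Definition inner_output (ys : nat -> Y) : bool :=
  if inner_hit ys is Some n then n%:R <= inner_horizon else false.

(* Expectation of N^b for i.i.d. observations with pmf p.  N^b is determined by
   the first L = Num.truncn inner_horizon observations, so it is computed on
   L + 1 i.i.d. coordinates; the extra one only ensures that x is nonempty, so
   that thead x can serve as the (irrelevant) default value of nth. *)
Definition inner_mean (p : {ffun Y -> R}) : R :=
  \sum_(x : (Num.truncn inner_horizon).+1.-tuple Y)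
     (\prod_(y <- x) p y) * (inner_length (nth (thead x) x))%:R.

End InnerTest.

Section OuterTest.
Variables (R : realType) (Y : finType) (M : nat) (M_gt0 : (0 < M)%N).

(* Outcomes (U_1, Z_1), ..., (U_t, Z_t), in chronological order. *)
Definition history := seq ('I_M * bool).

(* N(i,1) - N(i,0) *)
Definition score (h : history) (i : 'I_M) : int :=
  (count_mem (i, true) h)%:Z - (count_mem (i, false) h)%:Z.

(* A deterministic choice of a maximizer of the score. *)
Definition argmax_rule (r : history -> 'I_M) : Prop :=
  forall h i, score h i <= score h (r h).

(* sched t = Some k: the 1-based outer time t is a forced exploration time,
   t = floor(e^{bk}), and k is the selected index when there are several. *)
Definition exploration_schedule (b : R) (sched : nat -> option nat) : Prop :=
  forall t, if sched t is Some k then t = Num.truncn (expR (b * k%:R))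
            else forall k, t <> Num.truncn (expR (b * k%:R)).

Record test := Test {
  absence : {ffun Y -> R};
  test_rho1 : R;
  test_rho2 : R;
  sched : nat -> option nat;
  rule : history -> 'I_M;
  level : R (* the parameter a *)
}.

Variable S : test.
Let a := level S.

Definition estimate (h : history) : option 'I_M :=
  if 0 < score h (rule S h) then Some (rule S h) else None.

(* The location numbered (k mod M) + 1. *)
Definition cyclic_loc (k : nat) : 'I_M := Ordinal (ltn_pmod k M_gt0).

(* The location searched at the last time at which the estimate was 0.  The
   default cyclic_loc 0 of last is never reached by the policy: the estimate at
   time 1 is 0, and time 1 = floor(e^{b * 0}) is a forced exploration time. *)
Definition last_missing_loc (h : history) : 'I_M :=
  last (cyclic_loc 0)
    [seq (nth (cyclic_loc 0, false) h s).1
       | s <- iota 0 (size h) & estimate (take s h) == None].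

(* The location searched at time size h + 1; since u : 'I_M is location u + 1,
   the successor (i mod M) + 1 of i = u + 1 is cyclic_loc u.+1. *)
Definition search (h : history) : 'I_M :=
  if sched S (size h).+1 is Some k then cyclic_loc k
  else if estimate h is Some i then i
  else cyclic_loc (last_missing_loc h).+1.

Definition mismatched_law (i : option 'I_M) (u : 'I_M) (z : bool) : R :=
  if i == Some u then (if z then 1 - a^-1 else a^-1)
  else (if z then a^-1 else 1 - a^-1).

Definition mismatched_lik (i : option 'I_M) (h : history) : R :=
  \prod_(x <- h) mismatched_law i x.1 x.2.

Definition stop (h : history) : bool :=
  let ihat := estimate h in
  ((expR (a `^ test_rho2 S * ln a `^ test_rho1 S))%:E <
   \big[mine/+oo]_(j : option 'I_M | j != ihat)
      (mismatched_lik ihat h / mismatched_lik j h)%:E)%E.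

(* A run of the test.  obs t n is the n-th fresh observation available to the
   inner test at outer step t; the test reads it only when n < N^b_t. *)
Section Run.
Variable obs : nat -> nat -> Y.

Definition run_length (t : nat) : nat :=
  inner_length (absence S) (test_rho1 S) a (obs t).

Definition run_output (t : nat) : bool :=
  inner_output (absence S) (test_rho1 S) a (obs t).

Fixpoint run_history (t : nat) : history :=
  if t is s.+1 then
    rcons (run_history s) (search (run_history s), run_output s)
  else [::].

Definition run_loc (t : nat) : 'I_M := search (run_history t).

Definition run_tau : option nat :=
  first_time (fun t => (1 <= t)%N && stop (run_history t)).

(* None: the test never stops, hence takes no decision. *)
Definition run_decision : option (option 'I_M) :=
  if run_tau is Some t then Some (estimate (run_history t)) else None.

(* \sum_{t=1}^tau f_t, an infinite sum when the test does not stop. *)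
Definition run_sum (f : nat -> R) : \bar R :=
  (\sum_(0 <= t <oo | before run_tau t) (f t)%:E)%E.

End Run.

Section Model.
Variables (mu : {ffun Y -> R}) (i : option 'I_M).

Definition obs_law (u : 'I_M) : {ffun Y -> R} :=
  if i == Some u then mu else absence S.

(* c(i, u) *)
Definition cost (u : 'I_M) : R :=
  inner_mean (absence S) (test_rho1 S) a (obs_law u).

Variables (d : measure_display) (T : measurableType d) (P : probability T R).
Variable obs : nat -> nat -> T -> Y.

Let path (w : T) : nat -> nat -> Y := fun t n => obs t n w.

(* All observations taken before the n-th one of step t agree with h, the test
   takes an n-th observation in step t, and it takes it at location u. *)
Definition past_event (h : nat -> nat -> Y) (t n : nat) (u : 'I_M) : set T :=
  [set w | [/\ forall s m, (s < t)%N -> (m < run_length (path w) s)%N ->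
                 obs s m w = h s m,
               forall m, (m < n)%N -> obs t m w = h t m,
               (n < run_length (path w) t)%N
             & run_loc (path w) t = u]].

(* Given all past observations and search locations, each observation that is
   actually taken has pmf obs_law u, where u is the location being searched. *)
Definition observation_model : Prop :=
  (forall t n y, measurable [set w | obs t n w = y]) /\
  (forall h t n u y,
     P (past_event h t n u `&` [set w | obs t n w = y]) =
     ((obs_law u y)%:E * P (past_event h t n u))%E).

(* Never stopping counts as an error. *)
Definition error_event : set T :=
  [set w | run_decision (path w) <> Some i].

(* E_i[N] *)
Definition expected_samples : \bar R :=
  (\int[P]_w run_sum (path w) (fun t => (run_length (path w) t)%:R))%E.

(* E_i[\sum_{t=1}^tau c(i, U_t)] *)
Definition expected_cost : \bar R :=
  (\int[P]_w run_sum (path w) (fun t => cost (run_loc (path w) t)))%E.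

End Model.

End OuterTest.

(* Main.v *)
Require Import Defs.
From mathcomp Require Import all_boot all_order all_algebra.
From mathcomp Require Import all_classical all_reals all_analysis.
From mathcomp Require Import measurable_realfun.
From mathcomp Require Import zify ring lra.

Set Implicit Arguments.
Unset Strict Implicit.
Unset Printing Implicit Defensive.

Import Order.TTheory GRing.Theory Num.Theory.
Import numFieldNormedType.Exports.

Local Open Scope classical_set_scope.
Local Open Scope ring_scope.

(** Write T = a ^ rho2 (ln a) ^ rho1 for the threshold of the outer test, L for the
    horizon of the inner one and D for the relative entropy of mu with respect to pi.
    Everything rests on one remark: under the mismatched model the likelihood ratio
    of location v to hypothesis 0 is (a - 1) ^ score v, so that the outer test stops
    exactly when the score of the estimate leads all other scores, the constant score
    0 of hypothesis 0 included, by more than K = T / ln (a - 1) (stopP).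

    The inner test errs with probability of order at most 1 / a. Under pi the method
    of types bounds the probability of a crossing at time n by expR (- n ^ (2/3)) / a,
    which is summable (absence_crossing, false_alarm_le). Under mu the empirical law
    has at least the likelihood of mu, so the statistic dominates a random walk of
    drift D, and a Chernoff bound shows that the test takes (1 + o(1)) ln a / D
    observations and misses with a probability exponentially small in L
    (llr_le_relent_empirical, detection_time_le, missed_detection_le).

    Count the score of each location so that it goes up with the outputs that
    contradict the true hypothesis. Each of these error scores is then a walk with
    strongly negative drift, and expR (lam * error score) is a supermartingale for
    lam = (1 - delta) ln (a - 1) and large a. A wrong decision needs an error score to
    exceed K, which has probability at most expR (- lam * K) = expR (- (1 - delta) T);
    and the test stops correctly as soon as all error scores are below - K, which
    happens eventually because exploration visits every location infinitely often
    (ever_above_le, error_prob_le). Hence - ln Pmax >= nu1 T for every nu1 < 1 and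
    large a.

    For the cost under location v, each correct visit to v before stopping brings the
    score of v closer to the margin, so that the visits to v number at most
    1 + K + 2 * (wrong outputs), where wrong outputs are a vanishing fraction of all
    steps (target_visits_le). The steps elsewhere are forced explorations, whose
    number is logarithmic in the duration, and steps at which the estimate is wrong,
    whose mean number is bounded: at time t each location has been visited of the
    order of ln t times, which makes a wrong estimate polynomially unlikely in t, with
    an exponent that can be made large by increasing a (wrong_estimate_sum,
    mean_visits). A visit to v costs (1 + o(1)) ln a / D and any other at most
    L <= a (ln a) ^ rho1; as rho2 > 1, the latter are negligible with respect to T even
    though their mean number is of order ln T (near_wait_le). The mean cost is
    therefore at most (1 + o(1)) K ln a / D = (1 + o(1)) T / D.

    Since nu < 1, the two estimates combine with room to spare. That mean samples and
    mean cost agree is Wald's identity: whether step t takes place is decided by the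
    earlier outcomes, given which the inner test behaves as on i.i.d. observations
    (integral_step, expected_samplesE). *)

(** * Expectations of functions of finitely many i.i.d. observations *)

Section IidExpectation.
Variables (R : realType) (Y : finType).
Implicit Types (p : {ffun Y -> R}) (f g : seq Y -> R).

(** The recursion conditions on the first letter, which is what an induction along
    the observations of one inner test needs. *)
Fixpoint iid_mean p n f : R :=
  if n is k.+1 then \sum_y p y * iid_mean p k (fun s => f (y :: s)) else f [::].

Lemma iid_mean_tuple p n f :
  \sum_(x : n.-tuple Y) (\prod_(y <- x) p y) * f x = iid_mean p n f.
Proof.
elim: n f => [|n IHn] f /=.
  rewrite (bigD1 [tuple]) //= big_nil mul1r big1 ?addr0 // => x /eqP[].
  by rewrite (tuple0 x).
transitivity (\sum_y \sum_(x : n.-tuple Y)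
    p y * ((\prod_(z <- x) p z) * f (y :: x))); last first.
  by apply: eq_bigr => y _; rewrite -mulr_sumr (IHn (fun s => f (y :: s))).
rewrite pair_big /=.
rewrite (reindex (fun u : Y * n.-tuple Y => [tuple of u.1 :: u.2])) /=; last first.
  exists (fun x : n.+1.-tuple Y => (thead x, [tuple of behead x])) => [[y x] _|x _] /=.
    by congr pair; apply/val_inj.
  by case/tupleP: x => y x; apply/val_inj.
by apply: eq_bigr => -[y x] _ /=; rewrite big_cons mulrA.
Qed.

Lemma eq_iid_mean p n f g :
  (forall s, size s = n -> f s = g s) -> iid_mean p n f = iid_mean p n g.
Proof.
elim: n f g => [|n IHn] f g fg /=; first exact: fg.
by apply: eq_bigr => y _; congr (_ * _); apply: IHn => s sn; apply: fg; rewrite /= sn.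
Qed.

Lemma ler_iid_mean p n f g : (forall y, 0 <= p y) ->
  (forall s, size s = n -> f s <= g s) -> iid_mean p n f <= iid_mean p n g.
Proof.
move=> p0; elim: n f g => [|n IHn] f g fg /=; first exact: fg.
apply: ler_sum => y _; apply: ler_wpM2l => //.
by apply: IHn => s sn; apply: fg; rewrite /= sn.
Qed.

Lemma iid_meanZ p n c f : iid_mean p n (fun s => c * f s) = c * iid_mean p n f.
Proof.
elim: n f => [//|n IHn] f /=; rewrite mulr_sumr.
by apply: eq_bigr => y _; rewrite IHn mulrCA.
Qed.

Lemma iid_meanD p n f g :
  iid_mean p n (fun s => f s + g s) = iid_mean p n f + iid_mean p n g.
Proof.
elim: n f g => [//|n IHn] f g /=; rewrite -big_split /=.
by apply: eq_bigr => y _; rewrite IHn mulrDr.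
Qed.

Lemma iid_mean_sum (I : Type) (r : seq I) (Q : pred I) p n (F : I -> seq Y -> R) :
  iid_mean p n (fun s => \sum_(i <- r | Q i) F i s) =
  \sum_(i <- r | Q i) iid_mean p n (F i).
Proof.
elim: n F => [//|n IHn] F /=; rewrite exchange_big /=.
by apply: eq_bigr => y _; rewrite -mulr_sumr -IHn.
Qed.

Lemma iid_mean_prod p n (g : Y -> R) :
  iid_mean p n (fun s => \prod_(y <- s) g y) = (\sum_y p y * g y) ^+ n.
Proof.
elim: n => [|n IHn] /=; first by rewrite big_nil.
rewrite exprS -IHn mulr_suml; apply: eq_bigr => y _.
rewrite -mulrA; congr (_ * _); rewrite -iid_meanZ.
by apply: eq_iid_mean => s _; rewrite big_cons.
Qed.

Lemma iid_mean_cst p n c : \sum_y p y = 1 -> iid_mean p n (fun=> c) = c.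
Proof. by move=> p1; elim: n => //= n ->; rewrite -mulr_suml p1 mul1r. Qed.

Lemma iid_mean_take p m n f : \sum_y p y = 1 -> (m <= n)%N ->
  iid_mean p n (fun s => f (take m s)) = iid_mean p m f.
Proof.
move=> p1; elim: n m f => [|n IHn] [|m] f //= mn.
  under eq_bigr => y _ do rewrite iid_mean_cst //.
  by rewrite -mulr_suml p1 mul1r.
by apply: eq_bigr => y _; rewrite (IHn m (fun s => f (y :: s))).
Qed.

Lemma sum_count_mem (g : Y -> R) (s : seq Y) :
  \sum_y (count_mem y s)%:R * g y = \sum_(y <- s) g y.
Proof.
elim: s => [|z s IHs] /=; first by rewrite big_nil big1 // => y _; rewrite mul0r.
under eq_bigr => y _ do rewrite natrD mulrDl.
rewrite big_split /= IHs big_cons; congr (_ + _).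
rewrite (bigD1 z) //= eqxx mul1r big1 ?addr0 // => y yz.
by rewrite eq_sym (negbTE yz) mul0r.
Qed.

Lemma sum_count_mem_size (s : seq Y) : \sum_y (count_mem y s)%:R = (size s)%:R :> R.
Proof.
transitivity (\sum_(y <- s) (1 : R)).
  by rewrite -[RHS]sum_count_mem; apply: eq_bigr => y _; rewrite mulr1.
by rewrite big_const_seq count_predT iter_addr_0.
Qed.

End IidExpectation.

(** * Relative entropy *)

Section RelativeEntropy.
Variables (R : realType) (Y : finType).
Implicit Types p q : {ffun Y -> R}.

Lemma ln_leB1 (x : R) : 0 < x -> ln x <= x - 1.
Proof.
by move=> x0; rewrite -{1}(subrK 1 x) addrC; apply: le_ln1Dx; lra.
Qed.

Lemma ln_ltB1 (x : R) : 0 < x -> x != 1 -> ln x < x - 1.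
Proof.
move=> x0 x1; have s0 : 0 < Num.sqrt x by rewrite sqrtr_gt0.
(* comparing at the square root leaves the gap (sqrt x - 1)^2 *)
have -> : ln x = 2 * ln (Num.sqrt x).
  by rewrite -{1}(sqr_sqrtr (ltW x0)) lnXn // mulr_natl.
have s1 : Num.sqrt x != 1.
  by apply: contra x1 => /eqP s1; rewrite -(sqr_sqrtr (ltW x0)) s1 expr1n.
have gap : 0 < (Num.sqrt x - 1) ^+ 2 by rewrite exprn_even_gt0 //= subr_eq0.
have := ln_leB1 s0; have := sqr_sqrtr (ltW x0).
by move: gap; rewrite sqrrB1; lra.
Qed.

Let entropy_termE (x y : R) : 0 < x -> 0 < y -> x * ln (x / y) = - (x * ln (y / x)).
Proof.
by move=> x0 y0; rewrite -mulrN -lnV ?posrE ?divr_gt0 // invf_div.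
Qed.

Lemma entropy_term_ge (x y : R) : 0 <= x -> 0 < y -> x - y <= x * ln (x / y).
Proof.
rewrite le_eqVlt => /predU1P[<-|x0] y0; first by rewrite mul0r sub0r oppr_le0 ltW.
rewrite entropy_termE // lerNr opprB.
apply: le_trans (ler_wpM2l (ltW x0) (ln_leB1 (divr_gt0 y0 x0))) _.
by rewrite mulrBr mulr1 mulrCA divff ?gt_eqF // mulr1.
Qed.

Lemma entropy_term_gt (x y : R) : 0 < x -> 0 < y -> x != y -> x - y < x * ln (x / y).
Proof.
move=> x0 y0 xy; rewrite entropy_termE // ltrNr opprB.
have r1 : y / x != 1.
  by apply: contra xy => /eqP r1; rewrite -[x]mul1r -r1 divfK // gt_eqF.
have /lt_le_trans-> // : x * ln (y / x) < x * (y / x - 1).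
  by rewrite ltr_pM2l // ln_ltB1 ?divr_gt0.
by rewrite mulrBr mulr1 mulrCA divff ?gt_eqF // mulr1.
Qed.

Lemma relent_ge0 p q : (forall y, 0 <= p y) -> \sum_y p y = 1 -> full_pmf q ->
  0 <= relent p q.
Proof.
move=> p0 p1 [q0 q1].
have -> : 0 = \sum_y (p y - q y) by rewrite big_split /= sumrN p1 q1 subrr.
by apply: ler_sum => y _; apply: entropy_term_ge.
Qed.

Lemma relent_gt0 p q : full_pmf p -> full_pmf q -> p != q -> 0 < relent p q.
Proof.
move=> [p0 p1] [q0 q1] pq.
have [y pqy] : exists y, p y != q y.
  apply/existsP; apply: contraNT pq; rewrite negb_exists => /forallP pq.
  by apply/eqP/ffunP => y; apply/eqP; have := pq y; rewrite negbK.
have -> : 0 = \sum_y (p y - q y) by rewrite big_split /= sumrN p1 q1 subrr.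
rewrite /relent (bigD1 y) //= [ltRHS](bigD1 y) //=; apply: ltr_leD.
  exact: entropy_term_gt.
by apply: ler_sum => z _; apply: entropy_term_ge => //; apply: ltW.
Qed.

End RelativeEntropy.

(** * The inner test as a bounded stopping rule *)

Lemma first_timeP (p : pred nat) :
  match first_time p with
  | Some n => p n /\ (forall m, p m -> (n <= m)%N)
  | None => forall n, ~~ p n
  end.
Proof.
rewrite /first_time; case: pselect => [ex_p|nex_p].
  by case: ex_minnP => n pn le_n.
by move=> n; apply/negP => pn; apply: nex_p; exists n.
Qed.

Section InnerStopping.
Variables (R : realType) (Y : finType) (pi : {ffun Y -> R}) (rho1 a : R).
Hypothesis a_ge0 : 0 <= a.

Local Notation L := (Num.truncn (inner_horizon rho1 a)).
Local Notation len := (inner_length pi rho1 a).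
Local Notation out := (inner_output pi rho1 a).
Local Notation crossing := (inner_crossing pi a).
Implicit Types ys : nat -> Y.

Lemma inner_horizon_ge0 : 0 <= inner_horizon rho1 a.
Proof. by rewrite mulr_ge0 ?powR_ge0. Qed.

Lemma eq_crossing ys ys' n : (forall m, (m < n)%N -> ys m = ys' m) ->
  crossing ys n = crossing ys' n.
Proof.
move=> ysE; rewrite /inner_crossing.
suff -> : empirical R n ys = empirical R n ys' by [].
apply/ffunP => y; rewrite !ffunE; congr (_ %:R / _).
by congr count; apply/eq_in_map => m; rewrite mem_iota => /andP[_ /ysE].
Qed.

Lemma lt_inner_length ys n : reflect
  ((n < L)%N /\ (forall m, (0 < m)%N -> (m <= n)%N -> ~~ crossing ys m))
  (n < len ys)%N.
Proof.
rewrite /inner_length /inner_hit; set q := (X in first_time X).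
have := first_timeP q; case: first_time => [k [qk le_k]|nq]; apply: (iffP idP).
- rewrite leq_min => /andP[nk nL]; split=> // m m0 mn; apply/negP => cm.
  by have := le_k m; rewrite /q m0 cm => /(_ isT); rewrite leqNgt (leq_ltn_trans mn).
- case=> nL nc; rewrite leq_min nL andbT ltnNge; apply/negP => kn.
  by move: qk; rewrite /q => /andP[k0]; apply/negP/nc.
- by move=> nL; split=> // m m0 _; have := nq m; rewrite /q m0.
- by case.
Qed.

Lemma inner_length_le ys : (len ys <= L)%N.
Proof. by rewrite leqNgt; apply/negP => /lt_inner_length[]; rewrite ltnn. Qed.

Lemma inner_outputP ys : reflect
  (exists m, [/\ (0 < m)%N, (m <= L)%N & crossing ys m]) (out ys).
Proof.
rewrite /inner_output /inner_hit; set q := (X in first_time X).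
have := first_timeP q; case: first_time => [k [qk le_k]|nq]; last first.
  by apply: (iffP idP) => // -[m [m0 _ cm]]; have := nq m; rewrite /q m0 cm.
rewrite -truncn_ge_nat ?inner_horizon_ge0 //; apply: (iffP idP) => [kL|].
  by exists k; move: qk => /andP[].
by move=> [m [m0 mL cm]]; apply: leq_trans mL; apply: le_k; rewrite /q m0 cm.
Qed.

(** Whether the test continues after n observations is decided by these n. *)
Lemma inner_test_stopped ys ys' : (forall m, (m < len ys)%N -> ys m = ys' m) ->
  len ys = len ys' /\ out ys = out ys'.
Proof.
move=> ysE.
have lenE : len ys = len ys'.
  apply/eqP; rewrite eqn_leq; apply/andP; split; rewrite leqNgt; apply/negP.
    move=> lt; have /lt_inner_length[lL lc] := lt.
    suff : (len ys' < len ys')%N by rewrite ltnn.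
    apply/lt_inner_length; split=> // m m0 ml.
    rewrite -(@eq_crossing ys) ?lc // => k km; apply: ysE.
    by apply: leq_trans lt; apply: (leq_trans km); rewrite (leq_trans ml).
  move=> /lt_inner_length[lL lc].
  suff : (len ys < len ys)%N by rewrite ltnn.
  apply/lt_inner_length; split=> // m m0 ml.
  by rewrite (@eq_crossing _ ys') ?lc // => k km; apply: ysE; apply: leq_trans ml.
split=> //.
suff half : forall u v : nat -> Y, (forall m, (m < len u)%N -> u m = v m) ->
    out u -> out v.
  by apply/idP/idP; apply: half => // m; rewrite -lenE => /ysE.
move=> u v uv /inner_outputP /cid[m0 [m00 m0L c0]].
pose q m := (0 < m)%N && crossing u m.
have exq : exists m, q m by exists m0; rewrite /q m00.
case: (ex_minnP exq) => m /andP[m_gt0 cm] m_min.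
have mL : (m <= L)%N by apply: leq_trans m0L; apply: m_min; rewrite /q m00.
apply/inner_outputP; exists m; split=> //; rewrite -(@eq_crossing u) //.
have m_len : (m <= len u)%N.
  rewrite -(prednK m_gt0); apply/lt_inner_length.
  split; first by rewrite prednK.
  move=> k k0 km; apply/negP => ck; have := m_min k; rewrite /q k0 ck => /(_ isT).
  by rewrite leqNgt -(prednK m_gt0) ltnS km.
by move=> k km; apply: uv; apply: leq_trans m_len.
Qed.

End InnerStopping.

Section InnerExpectation.
Variables (R : realType) (Y : finType) (y0 : Y) (pi : {ffun Y -> R}) (rho1 a : R).
Hypotheses (a_ge0 : 0 <= a) (pi_pmf : full_pmf pi).

Local Notation L := (Num.truncn (inner_horizon rho1 a)).
Local Notation len := (inner_length pi rho1 a).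
Local Notation out := (inner_output pi rho1 a).
Local Notation crossing := (inner_crossing pi a).
Implicit Types p : {ffun Y -> R}.

Definition inner_avg p (F : (nat -> Y) -> R) : R :=
  iid_mean p L.+1 (fun s => F (nth y0 s)).

Lemma inner_meanE p : inner_mean pi rho1 a p = inner_avg p (fun ys => (len ys)%:R).
Proof.
rewrite /inner_avg -iid_mean_tuple; apply: eq_bigr => x _; congr (_ * _%:R).
have [] // := @inner_test_stopped _ _ pi rho1 a a_ge0 (nth (thead x) x) (nth y0 x).
move=> m /leq_trans/(_ (inner_length_le _ _ _ _)) mL.
by apply: set_nth_default; rewrite size_tuple ltnW.
Qed.

Definition inner_alarm_prob p : R := inner_avg p (fun ys => (out ys)%:R).

Section Bounds.
Variable p : {ffun Y -> R}.
Hypotheses (p_ge0 : forall y, 0 <= p y) (p1 : \sum_y p y = 1).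

Lemma inner_avg_le F G : (forall ys, F ys <= G ys) -> inner_avg p F <= inner_avg p G.
Proof. by move=> FG; apply: ler_iid_mean. Qed.

Lemma inner_avg_cst c : inner_avg p (fun=> c) = c.
Proof. exact: iid_mean_cst. Qed.

Lemma inner_alarm_prob_ge0 : 0 <= inner_alarm_prob p.
Proof. by rewrite -[leLHS](inner_avg_cst 0); apply: inner_avg_le => ys. Qed.

Lemma inner_alarm_prob_le1 : inner_alarm_prob p <= 1.
Proof.
by rewrite -[leRHS](inner_avg_cst 1); apply: inner_avg_le => ys; rewrite lern1 leq_b1.
Qed.

Lemma inner_mean_ge0 : 0 <= inner_mean pi rho1 a p.
Proof.
by rewrite inner_meanE -[leLHS](inner_avg_cst 0); apply: inner_avg_le => ys.
Qed.

Lemma inner_mean_leL : inner_mean pi rho1 a p <= L%:R.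
Proof.
rewrite inner_meanE -[leRHS](inner_avg_cst L%:R); apply: inner_avg_le => ys.
by rewrite ler_nat inner_length_le.
Qed.

Lemma inner_avg_out (c : bool -> R) : inner_avg p (fun ys => c (out ys)) =
  inner_alarm_prob p * c true + (1 - inner_alarm_prob p) * c false.
Proof.
rewrite /inner_alarm_prob -[X in (X - _)](inner_avg_cst 1) /inner_avg.
transitivity (iid_mean p L.+1 (fun s =>
  (c true - c false) * (out (nth y0 s))%:R + c false)).
  by apply: eq_iid_mean => s _; case: out; rewrite ?mulr1 ?mulr0 ?subrK ?add0r.
by rewrite iid_meanD iid_meanZ !iid_mean_cst //; ring.
Qed.

Lemma inner_avg_crossing (c : bool -> R) n : (n <= L)%N ->
  inner_avg p (fun ys => c (crossing ys n)) =
  iid_mean p n (fun s => c (crossing (nth y0 s) n)).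
Proof.
move=> nL; rewrite /inner_avg -[RHS](@iid_mean_take _ _ p n L.+1) ?leqW //.
apply: eq_iid_mean => s sL; congr c; apply: eq_crossing => m mn.
by rewrite nth_take.
Qed.

End Bounds.

(** * False alarms: the method of types *)

Lemma empirical_seq (s : seq Y) (y : Y) :
  empirical R (size s) (nth y0 s) y = (count_mem y s)%:R / (size s)%:R.
Proof. by rewrite ffunE mkseq_nth. Qed.

Lemma size_relent_empirical (s : seq Y) q : (0 < size s)%N ->
  (size s)%:R * relent (empirical R (size s) (nth y0 s)) q =
  \sum_(y <- s) ln (empirical R (size s) (nth y0 s) y / q y).
Proof.
move=> s0; rewrite -sum_count_mem mulr_sumr; apply: eq_bigr => y _.
by rewrite {1}empirical_seq mulrA mulrCA divff ?mulr1 // pnatr_eq0 -lt0n.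
Qed.

(** Maximizing the likelihood over the law costs at most the number of types,
    since the words of a given type have total probability at most 1 under it. *)
Lemma sum_max_likelihood n : (0 < n)%N ->
  \sum_(s : n.-tuple Y) \prod_(y <- s) ((count_mem y s)%:R / n%:R)
    <= (n%:R + 1) ^+ #|Y| :> R.
Proof.
move=> n0; pose counts (s : n.-tuple Y) : {ffun Y -> 'I_n.+1} :=
  [ffun y => inord (count_mem y s)].
have countsE s y : counts s y = count_mem y s :> nat.
  by rewrite ffunE inordK // ltnS -[X in (_ <= X)%N](size_tuple s) count_size.
rewrite (partition_big counts predT) //=.
have -> : (n%:R + 1) ^+ #|Y| = \sum_(c : {ffun Y -> 'I_n.+1}) (1 : R).
  by rewrite sumr_const card_ffun card_ord natrX -natr1.
apply: ler_sum => c _.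
have [s0 /eqP s0c|nos] := pickP (fun s => counts s == c); last first.
  by rewrite big_pred0.
pose q : {ffun Y -> R} := [ffun y => (c y)%:R / n%:R].
have q1 : \sum_y q y = 1.
  transitivity (\sum_y (count_mem y s0)%:R / n%:R : R).
    by apply: eq_bigr => y _; rewrite ffunE -s0c countsE.
  by rewrite -mulr_suml sum_count_mem_size size_tuple divff // pnatr_eq0 -lt0n.
rewrite -[leRHS](iid_mean_cst n 1 q1) -iid_mean_tuple.
rewrite [leRHS](bigID (fun s => counts s == c)) /= -[leLHS]addr0.
apply: lerD; last first.
  apply: sumr_ge0 => s _; rewrite mulr1; apply: prodr_ge0 => y _.
  by rewrite ffunE divr_ge0.
apply: ler_sum => s /eqP sc; rewrite mulr1 le_eqVlt; apply/orP; left; apply/eqP.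
by apply: eq_bigr => y _; rewrite ffunE -sc countsE.
Qed.

Lemma prod_expR_ln (s : seq Y) (u v : Y -> R) :
  {in s, forall y, 0 < u y} -> {in s, forall y, 0 < v y} ->
  \prod_(y <- s) v y = expR (- \sum_(y <- s) ln (u y / v y)) * \prod_(y <- s) u y.
Proof.
move=> u0 v0; rewrite -sumrN expR_sum -big_split /=.
rewrite big_seq [RHS]big_seq; apply: eq_bigr => y ys.
have [uy vy] := (u0 y ys, v0 y ys).
by rewrite -lnV ?posrE ?divr_gt0 // lnK ?posrE ?invr_gt0 ?divr_gt0 // invf_div divfK ?gt_eqF.
Qed.

Lemma absence_crossing n : 0 < a -> (0 < n)%N ->
  iid_mean pi n (fun s => (crossing (nth y0 s) n)%:R) <= expR (- n%:R `^ (2 / 3)) / a.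
Proof.
move=> a0 n0; have [pi0 _] := pi_pmf; rewrite -iid_mean_tuple.
pose thr : R := ln a + n%:R `^ (2 / 3) + #|Y|%:R * ln (n%:R + 1).
apply: (@le_trans _ _ (\sum_(s : n.-tuple Y)
    expR (- thr) * \prod_(y <- s) ((count_mem y s)%:R / n%:R))).
  apply: ler_sum => s _.
  have prod0 : 0 <= \prod_(y <- s) ((count_mem y s)%:R / n%:R) :> R.
    by apply: prodr_ge0 => y _; rewrite divr_ge0.
  case crs: crossing; last by rewrite mulr0 mulr_ge0 ?expR_ge0.
  have sn : size s = n by rewrite size_tuple.
  rewrite mulr1 (@prod_expR_ln s (fun y => (count_mem y s)%:R / n%:R)) //; last first.
    by move=> y ys; rewrite divr_gt0 ?ltr0n // -has_count has_pred1.
  apply: ler_wpM2r => //; rewrite ler_expR lerN2.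
  move: crs; rewrite /inner_crossing => /ltW/le_trans; apply.
  rewrite -{1 2}sn size_relent_empirical; last by rewrite sn.
  rewrite le_eqVlt; apply/orP; left; apply/eqP.
  by apply: eq_bigr => y _; rewrite empirical_seq sn.
rewrite -mulr_sumr.
apply: (@le_trans _ _ (expR (- thr) * (n%:R + 1) ^+ #|Y|)).
  by rewrite ler_wpM2l ?expR_ge0 ?sum_max_likelihood.
have n1 : 0 < n%:R + 1 :> R by rewrite ltr_wpDl.
have -> : a^-1 = expR (- ln a) by rewrite expRN lnK.
rewrite -[X in X ^+ _](lnK n1) -expRM_natl -!expRD.
by rewrite ler_expR /thr; lra.
Qed.

End InnerExpectation.

Section InnerBounds.
Variables (R : realType) (Y : finType) (y0 : Y) (pi : {ffun Y -> R}) (rho1 a : R).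
Hypotheses (a_gt0 : 0 < a) (pi_pmf : full_pmf pi).

Local Notation L := (Num.truncn (inner_horizon rho1 a)).
Local Notation len := (inner_length pi rho1 a).
Local Notation out := (inner_output pi rho1 a).
Local Notation crossing := (inner_crossing pi a).
Local Notation inner_alarm_prob := (inner_alarm_prob y0 pi rho1 a).

Let a_ge0 : 0 <= a := ltW a_gt0.

Lemma expRN_powR23_le n : (0 < n)%N -> expR (- n%:R `^ (2 / 3)) <= 6 / n%:R ^+ 2 :> R.
Proof.
move=> n0; have n0' : 0 < n%:R :> R by rewrite ltr0n.
rewrite expRN -[leRHS]invrK lef_pV2 ?posrE ?invr_gt0 ?divr_gt0 ?expR_gt0 ?exprn_gt0 //.
rewrite invf_div.
have -> : n%:R ^+ 2 / 6 = (n%:R `^ (2 / 3)) ^+ 3 / 3`!%:R :> R.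
  congr (_ / _).
  rewrite -[RHS]powR_mulrn ?powR_ge0 // -powRrM divfK //.
  by rewrite powR_mulrn // ltW.
have := @expR_ge1Dxn R (n%:R `^ (2 / 3)) 2 (powR_ge0 _ _).
by move/(le_trans _); apply; rewrite lerDr.
Qed.

Lemma sum_inv_sqr_le m : \sum_(n < m) (n.+1%:R ^+ 2)^-1 <= 2 :> R.
Proof.
suff : \sum_(n < m) (n.+1%:R ^+ 2)^-1 <= 2 - 2 / m.+1%:R :> R.
  by move/le_trans; apply; rewrite lerBlDr lerDl divr_ge0.
elim: m => [|m IHm]; first by rewrite big_ord0 divr1 subrr.
rewrite big_ord_recr /=; apply: le_trans (lerD IHm (lexx _)) _.
have x0 : 0 < m.+1%:R :> R by [].
rewrite -[m.+2%:R]natr1; have x1 : 1 <= m.+1%:R :> R by rewrite ler1n.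
move: (m.+1%:R) x0 x1 => x x0 x1.
rewrite -subr_ge0 (_ : _ - _ = (x - 1) / (x ^+ 2 * (x + 1))).
  by rewrite divr_ge0 ?subr_ge0 // mulr_ge0 ?exprn_ge0 ?addr_ge0 // ltW.
by field; rewrite !gt_eqF // addr_gt0.
Qed.

(** The term n^(2/3) of the threshold makes the false alarm probabilities at the
    successive n summable uniformly in a. *)
Lemma false_alarm_le : inner_alarm_prob pi <= 12 / a.
Proof.
have [pi0 pi1] := pi_pmf; have pi_ge0 y : 0 <= pi y := ltW (pi0 y).
apply: (@le_trans _ _ (inner_avg y0 rho1 a pi
  (fun ys => \sum_(n < L) (crossing ys n.+1)%:R))).
  apply: inner_avg_le => // ys; case: inner_outputP => //; last by rewrite sumr_ge0.
  move=> [[|m] [m0 mL cm]]; first by [].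
  rewrite (bigD1 (Ordinal mL)) //= cm lerDl.
  exact: sumr_ge0.
rewrite /inner_avg iid_mean_sum.
apply: (@le_trans _ _ (\sum_(n < L) 6 / a * (n.+1%:R ^+ 2)^-1)).
  apply: ler_sum => n _.
  have := @inner_avg_crossing _ _ y0 pi rho1 a pi pi1 (fun c : bool => c%:R) _ (ltn_ord n).
  rewrite /inner_avg => ->; apply: le_trans (absence_crossing _ _ _ _) _ => //.
  by rewrite mulrAC ler_pM2r ?invr_gt0 // expRN_powR23_le.
rewrite -mulr_sumr; apply: le_trans (ler_wpM2l _ (sum_inv_sqr_le L)) _.
  by rewrite divr_ge0.
by rewrite le_eqVlt; apply/orP; left; apply/eqP; field; rewrite gt_eqF.
Qed.

End InnerBounds.

(** * Detection: a Chernoff bound for the log-likelihood ratio walk *)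

Lemma expR_le_quadratic (R : realType) (x : R) : x <= 1 / 2 ->
  expR x <= 1 + x + 2 * x ^+ 2.
Proof.
move=> x12; have x1 : 0 < 1 - x by lra.
rewrite -[x in expR x]opprK expRN; apply: (@le_trans _ _ (1 - x)^-1).
  by rewrite lef_pV2 ?posrE ?expR_gt0 // expR_ge1Dx.
rewrite -div1r ler_pdivrMr //.
have -> : (1 + x + 2 * x ^+ 2) * (1 - x) = 1 + x ^+ 2 * (1 - 2 * x) by ring.
by rewrite lerDl mulr_ge0 ?sqr_ge0 //; lra.
Qed.

Section Detection.
Variables (R : realType) (Y : finType) (mu pi : {ffun Y -> R}).
Hypotheses (mu_pmf : full_pmf mu) (pi_pmf : full_pmf pi).
Local Notation D := (relent mu pi).

(** To first order in c the sum is 1 - c * xi, since xi is the mean of the shifted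
    log-likelihood ratio. *)
Lemma chernoff_rate (xi : R) : 0 < xi -> exists c : R, 0 < c /\
  \sum_y mu y * expR (- c * (ln (mu y / pi y) - (D - xi))) < 1.
Proof.
move=> xi0; have [mu0 mu1] := mu_pmf.
pose X y := ln (mu y / pi y) - (D - xi).
pose V := \sum_y mu y * X y ^+ 2.
have V0 : 0 <= V by apply: sumr_ge0 => y _; rewrite mulr_ge0 ?sqr_ge0 // ltW.
pose B := \sum_y `|X y|.
have B0 : 0 <= B by apply: sumr_ge0.
have XB y : `|X y| <= B by rewrite /B (bigD1 y) //= lerDl sumr_ge0.
have meanX : \sum_y mu y * X y = xi.
  under eq_bigr do rewrite /X mulrBr.
  by rewrite sumrB -mulr_suml mu1 mul1r /relent; ring.
pose c := Num.min (xi / (4 * (V + 1))) (1 / (2 * (B + 1))).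
have c0 : 0 < c by rewrite lt_min !divr_gt0 ?mulr_gt0 // ltr_wpDl.
have cV : c * (4 * (V + 1)) <= xi.
  by rewrite -ler_pdivlMr ?ge_min ?lexx // mulr_gt0 // ltr_wpDl.
have cB : c * (2 * (B + 1)) <= 1.
  by rewrite -ler_pdivlMr ?ge_min ?lexx ?orbT // mulr_gt0 // ltr_wpDl.
exists c; split=> //.
apply: (@le_lt_trans _ _ (\sum_y mu y * (1 + - c * X y + 2 * (- c * X y) ^+ 2))).
  apply: ler_sum => y _; apply: ler_wpM2l; first exact: ltW.
  apply: expR_le_quadratic; rewrite mulNr -mulrN.
  apply: (@le_trans _ _ (c * B)); last by nra.
  rewrite ler_pM2l //; apply: le_trans (XB y).
  by rewrite -normrN ler_norm.
have -> : \sum_y mu y * (1 + - c * X y + 2 * (- c * X y) ^+ 2) =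
    1 - c * xi + 2 * c ^+ 2 * V.
  transitivity (\sum_y (mu y - c * (mu y * X y) + 2 * c ^+ 2 * (mu y * X y ^+ 2))).
    by apply: eq_bigr => y _; ring.
  by rewrite big_split /= sumrB -!mulr_sumr mu1 meanX.
by nra.
Qed.

Variables (y0 : Y) (rho1 a : R).
Hypothesis a_ge0 : 0 <= a.

Local Notation L := (Num.truncn (inner_horizon rho1 a)).
Local Notation len := (inner_length pi rho1 a).
Local Notation out := (inner_output pi rho1 a).
Local Notation crossing := (inner_crossing pi a).

(** The empirical law beats mu in likelihood: this is where the test does not
    need to know mu. *)
Lemma llr_le_relent_empirical (s : seq Y) : (0 < size s)%N ->
  \sum_(y <- s) ln (mu y / pi y) <=
  (size s)%:R * relent (empirical R (size s) (nth y0 s)) pi.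
Proof.
move=> s0; have [mu0 _] := mu_pmf; have [pi0 _] := pi_pmf.
pose g := empirical R (size s) (nth y0 s).
have gE y : g y = (count_mem y s)%:R / (size s)%:R by apply: empirical_seq.
have s0' : 0 < (size s)%:R :> R by rewrite ltr0n.
rewrite size_relent_empirical // -subr_ge0 -sumrB.
have -> : \sum_(y <- s) (ln (g y / pi y) - ln (mu y / pi y)) =
    \sum_(y <- s) ln (g y / mu y).
  rewrite big_seq [RHS]big_seq; apply: eq_bigr => y ys.
  have gy : 0 < g y by rewrite gE divr_gt0 // ltr0n -has_count has_pred1.
  by rewrite !ln_div ?posrE //; ring.
rewrite -size_relent_empirical // mulr_ge0 // relent_ge0 // => [y|].
  by rewrite gE divr_ge0.
by under eq_bigr do rewrite gE; rewrite -mulr_suml sum_count_mem_size divff ?gt_eqF.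
Qed.

Variables (xi c : R).
Hypothesis c_gt0 : 0 < c.
Let r := \sum_y mu y * expR (- c * (ln (mu y / pi y) - (D - xi))).
Hypothesis r_lt1 : r < 1.

Let r_ge0 : 0 <= r.
Proof. by apply: sumr_ge0 => y _; rewrite mulr_ge0 ?expR_ge0 // ltW // mu_pmf.1. Qed.

Lemma no_crossing_le n : (0 < n)%N ->
  ln a + n%:R `^ (2 / 3) + #|Y|%:R * ln (n%:R + 1) <= n%:R * (D - xi) ->
  iid_mean mu n (fun s => (~~ crossing (nth y0 s) n)%:R) <= r ^+ n.
Proof.
move=> n0 thr; rewrite /r -iid_mean_prod.
apply: ler_iid_mean => [y|s sn]; first by rewrite ltW // mu_pmf.1.
have prod0 : 0 <= \prod_(y <- s) expR (- c * (ln (mu y / pi y) - (D - xi))).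
  by apply: prodr_ge0 => y _; apply: expR_ge0.
case crs: crossing => //=; rewrite -expR_sum -[leLHS]expR0 ler_expR.
rewrite -mulr_sumr mulNr -mulrN; apply: mulr_ge0; first exact: ltW.
rewrite oppr_ge0 sumrB big_const_seq.
rewrite count_predT iter_addr_0 sn subr_le0 -[leRHS]mulr_natl.
have := llr_le_relent_empirical; move=> /(_ s); rewrite sn => /(_ n0) /le_trans; apply.
by apply: le_trans thr; move/negbT: crs; rewrite /inner_crossing -leNgt.
Qed.

Variable N0 : nat.
Hypothesis N0_gt0 : (0 < N0)%N.
Hypothesis N0_thr : forall n, (N0 <= n)%N ->
  ln a + n%:R `^ (2 / 3) + #|Y|%:R * ln (n%:R + 1) <= n%:R * (D - xi).

Lemma missed_detection_le : (N0 <= L)%N ->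
  1 - inner_alarm_prob y0 pi rho1 a mu <= r ^+ L.
Proof.
move=> NL; have [mu0 mu1] := mu_pmf; have mu_ge0 y : 0 <= mu y := ltW (mu0 y).
have L0 : (0 < L)%N := leq_trans N0_gt0 NL.
apply: le_trans (no_crossing_le L0 (N0_thr NL)).
rewrite -(@inner_avg_crossing _ _ y0 pi rho1 a mu mu1 (fun b : bool => (~~ b)%:R)) //.
have := @inner_avg_out _ _ y0 pi rho1 a _ mu1 (fun b : bool => (~~ b)%:R).
rewrite mulr0 add0r mulr1 => <-; apply: inner_avg_le => // ys.
rewrite ler_nat; case cL: (crossing ys L) => /=; last exact: leq_b1.
by rewrite (_ : out ys) //; apply/inner_outputP => //; exists L.
Qed.

Lemma detection_time_le : inner_mean pi rho1 a mu <= N0%:R + (1 - r)^-1.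
Proof.
have [mu0 mu1] := mu_pmf; have mu_ge0 y : 0 <= mu y := ltW (mu0 y).
rewrite (inner_meanE y0) //.
apply: (@le_trans _ _ (inner_avg y0 rho1 a mu
    (fun ys => N0%:R + \sum_(n < L | (N0 <= n)%N) (~~ crossing ys n)%:R))).
  apply: inner_avg_le => // ys; rewrite -natr_sum -natrD ler_nat.
  have lenP m : (minn (len ys) m <=
      N0 + \sum_(n < m | (N0 <= n)%N) (~~ crossing ys n))%N.
    elim: m => [|m IHm]; first by rewrite minn0.
    rewrite big_mkcond big_ord_recr /= -big_mkcond /=.
    have [mN|Nm] := ltnP m N0; first by rewrite geq_min orbC (leq_trans mN) ?leq_addr.
    rewrite addnA; apply: (@leq_trans (minn (len ys) m + (m < len ys))%N).
      by case: (ltnP m (len ys)) => /=; lia.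
    apply: leq_add => //; case: lt_inner_length => // -[_ /(_ m) nc].
    by rewrite nc // (leq_trans N0_gt0).
  by have := lenP L; rewrite (minn_idPl _) ?inner_length_le.
rewrite /inner_avg iid_meanD iid_mean_cst // lerD2l iid_mean_sum.
apply: (@le_trans _ _ (\sum_(n < L) r ^+ n)).
  rewrite big_mkcond; apply: ler_sum => n _; case: leqP => Nn; last exact: exprn_ge0.
  have := @inner_avg_crossing _ _ y0 pi rho1 a mu mu1 (fun b : bool => (~~ b)%:R) _ (ltnW (ltn_ord n)).
  rewrite /inner_avg => ->; apply: no_crossing_le; last exact: N0_thr.
  exact: leq_trans Nn.
have r1 : 0 < 1 - r by rewrite subr_gt0.
rewrite -div1r ler_pdivlMr // mulrC -opprB mulNr -subrX1 opprB.
by rewrite lerBlDr lerDl exprn_ge0.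
Qed.

End Detection.

(** * Scores, mismatched likelihoods and the stopping region *)

Section Scores.
Variables (R : realType) (Y : finType) (M : nat).
Variable S : test R Y M.
Hypothesis ruleP : argmax_rule (rule S).
Local Notation a := (level S).
Implicit Types (h : history M) (x : 'I_M * bool) (i j : option 'I_M) (u v : 'I_M).

Lemma score_rcons h x u : score (rcons h x) u =
  score h u + (if x.1 == u then (if x.2 then 1 else -1) else 0).
Proof.
case: x => w z; rewrite /score -!cats1 !count_cat /= !addn0 !xpair_eqE.
by case: eqP => _; case: z; rewrite /= ?addn0; lia.
Qed.

(** The mismatched log-likelihood of j, up to a term common to all hypotheses, in
    units of ln (a - 1). *)
Definition hyp_score h j : int := if j is Some v then score h v else 0.

Lemma mismatched_likE j h : 1 < a ->
  mismatched_lik S j h =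
  mismatched_lik S None h * expR (ln (a - 1) * (hyp_score h j)%:~R).
Proof.
move=> a1; have a0 : 0 < a by lra.
case: j => [v|]; last by rewrite /= mulr0z mulr0 expR0 mulr1.
elim/last_ind: h => [|h x IHh].
  by rewrite /mismatched_lik !big_nil /= (_ : score [::] v = 0) // mulr0z mulr0 expR0 mulr1.
rewrite /mismatched_lik !big_rcons -!/(mismatched_lik _ _ _) IHh /= score_rcons.
move: (score h v) => sc; rewrite rmorphD /= mulrDr expRD /mismatched_law /= !mulrA.
have e1 : expR (ln (a - 1)) = a - 1 by rewrite lnK // posrE subr_gt0.
have an0 : a != 0 by rewrite gt_eqF.
have am0 : a - 1 != 0 by rewrite gt_eqF // subr_gt0.
rewrite (_ : (Some v == Some x.1) = (x.1 == v)); last by rewrite eq_sym.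
case: eqP => _; last by rewrite mulr0z mulr0 expR0; ring.
case: x.2; rewrite ?mulrN1z ?mulr1z ?mulr1 ?mulrN1 ?expRN e1.
  by field; rewrite an0.
by field; rewrite an0 am0.
Qed.

Lemma mismatched_lik_gt0 j h : 1 < a -> 0 < mismatched_lik S j h.
Proof.
move=> a1; apply: prodr_gt0 => x _; rewrite /mismatched_law.
have : a^-1 < 1 by rewrite invf_lt1; lra.
have : 0 < a^-1 by rewrite invr_gt0; lra.
by move=> ? ?; case: ifP; case: ifP => *; lra.
Qed.

(** The threshold of the log-likelihood ratios, in units of ln (a - 1). *)
Definition margin : R :=
  a `^ test_rho2 S * ln a `^ test_rho1 S / ln (a - 1).

Lemma margin_ge0 : 2 < a -> 0 <= margin.
Proof. by move=> a2; rewrite divr_ge0 ?mulr_ge0 ?powR_ge0 // ln_ge0; lra. Qed.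

Lemma stopP h : 2 < a -> reflect
  (forall j, j != estimate S h ->
     margin < (hyp_score h (estimate S h) - hyp_score h j)%:~R)
  (stop S h).
Proof.
move=> a2; have a1 : 1 < a by lra.
have l0 : 0 < ln (a - 1) by rewrite ln_gt0; lra.
have ratioE j : expR (a `^ test_rho2 S * ln a `^ test_rho1 S) <
    mismatched_lik S (estimate S h) h / mismatched_lik S j h =
    (margin < (hyp_score h (estimate S h) - hyp_score h j)%:~R).
  rewrite (mismatched_likE (estimate S h)) // (mismatched_likE j) // rmorphB /=.
  rewrite -mulf_div divff ?gt_eqF ?mismatched_lik_gt0 // mul1r -expRN -expRD ltr_expR.
  by rewrite /margin ltr_pdivrMr // -mulrBr [ln _ * (_ - _)]mulrC.
apply: (iffP idP).
  by move=> /bigmin_gtP[_ lt] j jh; rewrite -ratioE -lte_fin; apply: lt.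
move=> lt; apply/bigmin_gtP; split; first exact: ltry.
by move=> j jh; rewrite lte_fin ratioE; apply: lt.
Qed.

Lemma estimate_Some h v : 0 < score h v ->
  (forall u, u != v -> score h u < score h v) -> estimate S h = Some v.
Proof.
move=> v0 lt; rewrite /estimate.
suff -> : rule S h = v by rewrite v0.
apply/eqP; apply: contraT => /lt; rewrite ltNge => /negP[]; exact: ruleP.
Qed.

Lemma estimate_None h : (forall u, score h u <= 0) -> estimate S h = None.
Proof. by move=> le; rewrite /estimate ltNge le. Qed.

(** The score of u counted so that it increases with the outputs contradicting
    hypothesis i; under hypothesis i it has negative drift for every u. *)
Definition err_score i h u : int := if i == Some u then - score h u else score h u.

Definition wrong i x : bool := x.2 != (i == Some x.1).

Lemma err_score_rcons i h x u : err_score i (rcons h x) u =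
  err_score i h u + (if x.1 == u then (if wrong i x then 1 else -1) else 0).
Proof.
rewrite /err_score /wrong score_rcons.
have [->|_] := eqVneq x.1 u; last by case: eqP => _; rewrite !addr0.
by case: eqP => _; case: x.2; rewrite /=; lia.
Qed.

Lemma estimate_correct i h : (forall u, err_score i h u < 0) -> estimate S h = i.
Proof.
case: i => [v|] lt; last first.
  by apply: estimate_None => u; apply: ltW; have := lt u; rewrite /err_score.
have v0 : 0 < score h v by have := lt v; rewrite /err_score eqxx; lia.
apply: estimate_Some => // u uv; apply: lt_trans v0.
by have := lt u; rewrite /err_score (inj_eq Some_inj) eq_sym (negbTE uv).
Qed.

Lemma stop_correct i h : 2 < a ->
  (forall u, (err_score i h u)%:~R < - margin) -> stop S h /\ estimate S h = i.
Proof.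
move=> a2 lt; have K0 := margin_ge0 a2.
have ih : estimate S h = i.
  apply: estimate_correct => u; rewrite -(ltr_int R).
  by apply: lt_le_trans (lt u) _; rewrite oppr_le0.
split=> //; apply/stopP => // j; rewrite ih => ji.
rewrite rmorphB /=; case: i {ih} lt ji => [v|] lt ji.
  have ltv : margin < (score h v)%:~R.
    by have := lt v; rewrite /err_score eqxx rmorphN /= ltrN2.
  case: j ji => [u|] ji; rewrite /= ?subr0 //.
  have := lt u; rewrite /err_score eq_sym (negbTE ji) => {}lt.
  by apply: lt_le_trans ltv _; rewrite lerBrDr gerDl; apply: le_trans (ltW lt) _;
     rewrite oppr_le0.
case: j ji => [u|] //= _; have := lt u.
by rewrite /err_score /= sub0r ltrNr.
Qed.

Lemma stop_error i h : 2 < a -> stop S h -> estimate S h != i ->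
  exists u, margin < (err_score i h u)%:~R.
Proof.
move=> a2 /(stopP _ a2); case: (estimate S h) => [v|] lt vi.
  exists v; rewrite /err_score eq_sym (negbTE vi).
  by have := lt None isT; rewrite /= subr0.
case: i vi => [u|] // _; exists u; rewrite /err_score eqxx.
by have := lt (Some u) isT; rewrite /= sub0r.
Qed.

(** Once v leads 0 and all other locations by more than the margin, v is the
    estimate and the test stops. *)
Lemma not_stop_score v h : 2 < a -> ~~ stop S h ->
  (score h v)%:~R <= margin \/
  exists2 u, u != v & (score h v - score h u)%:~R <= margin.
Proof.
move=> a2 ns; have K0 := margin_ge0 a2.
have [|vK] := leP (score h v)%:~R margin; first by left.
have [/existsP[u /andP[uv uK]]|no] :=
  boolP [exists u, (u != v) && ((score h v - score h u)%:~R <= margin)].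
  by right; exists u.
exfalso; move: ns; apply/negP; rewrite negbK.
have uK u : u != v -> margin < (score h v - score h u)%:~R.
  move=> uv; rewrite ltNge; apply: contra no => uK.
  by apply/existsP; exists u; rewrite uv.
have ev : estimate S h = Some v.
  apply: estimate_Some => [|u uv]; first by rewrite -(ltr_int R) (le_lt_trans K0).
  by rewrite -subr_gt0 -(ltr_int R) (le_lt_trans K0) ?uK.
apply/stopP => // j; rewrite ev; case: j => [u|] /= jv; last by rewrite subr0.
exact: uK.
Qed.

End Scores.

(** * Expectations over outcome histories *)

Section HistoryMean.
Variables (R : realType) (Y : finType) (M : nat) (M_gt0 : (0 < M)%N).
Variables (S : test R Y M) (q : 'I_M -> R).
Hypotheses (q_ge0 : forall u, 0 <= q u) (q_le1 : forall u, q u <= 1).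
Implicit Types (h g : history M) (f : history M -> R) (u : 'I_M).
Implicit Types c : history M -> 'I_M * bool -> R.
Local Notation search := (search M_gt0 S).

(** A search of u outputs 1 with probability q u, whatever the past. *)
Definition next_mean f h : R :=
  q (search h) * f (rcons h (search h, true)) +
  (1 - q (search h)) * f (rcons h (search h, false)).

(** The last step is averaged first, so that a supermartingale inequality for
    next_mean propagates by induction on t. *)
Fixpoint hist_mean t f : R :=
  if t is s.+1 then hist_mean s (next_mean f) else f [::].

Inductive reachable : history M -> Prop :=
| reachable0 : reachable [::]
| reachableS h z : reachable h -> reachable (rcons h (search h, z)).

Lemma reachable_prefix h n : reachable h -> (n < size h)%N ->
  reachable (take n h) /\
  forall x, (nth x h n).1 = search (take n h).
Proof.
elim=> [|{}h z rh IHh] //; rewrite size_rcons ltnS => nh.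
rewrite -cats1 takel_cat //; split=> [|x].
  move: nh; rewrite leq_eqVlt => /predU1P[->|/IHh[] //].
  by rewrite take_size.
move: nh; rewrite leq_eqVlt => /predU1P[->|nh].
  by rewrite nth_cat ltnn subnn take_size.
by rewrite nth_cat nh; apply: (IHh nh).2.
Qed.

Let qC_ge0 u : 0 <= 1 - q u. Proof. by rewrite subr_ge0. Qed.

Lemma ler_hist_mean t f (f' : history M -> R) :
  (forall h, reachable h -> size h = t -> f h <= f' h) -> hist_mean t f <= hist_mean t f'.
Proof.
elim: t f f' => [|t IHt] f f' ff' /=; first by apply: ff' => //; apply: reachable0.
apply: IHt => h rh ht; apply: lerD; apply: ler_wpM2l => //;
  by apply: ff'; [exact: reachableS|rewrite size_rcons ht].
Qed.

Lemma eq_hist_mean t f (f' : history M -> R) :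
  (forall h, reachable h -> size h = t -> f h = f' h) -> hist_mean t f = hist_mean t f'.
Proof.
by move=> ff'; apply: le_anti; apply/andP; split; apply: ler_hist_mean => h rh ht;
  rewrite ff'.
Qed.

Lemma hist_meanD t f (f' : history M -> R) :
  hist_mean t (fun h => f h + f' h) = hist_mean t f + hist_mean t f'.
Proof.
elim: t f f' => [//|t IHt] f f' /=; rewrite -IHt.
by apply: eq_hist_mean => h _ _; rewrite /next_mean; ring.
Qed.

Lemma hist_meanZ t (k : R) f : hist_mean t (fun h => k * f h) = k * hist_mean t f.
Proof.
elim: t f => [//|t IHt] f /=; rewrite -IHt.
by apply: eq_hist_mean => h _ _; rewrite /next_mean; ring.
Qed.

Lemma hist_mean_cst t (k : R) : hist_mean t (fun=> k) = k.
Proof.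
elim: t => [//|t IHt] /=; rewrite -[RHS]IHt.
by apply: eq_hist_mean => h _ _; rewrite /next_mean; ring.
Qed.

Lemma hist_mean_ge0 t f : (forall h, 0 <= f h) -> 0 <= hist_mean t f.
Proof. by move=> f0; rewrite -(hist_mean_cst t 0); apply: ler_hist_mean => h. Qed.

Lemma hist_mean_sum (I : Type) (r : seq I) t (F : I -> history M -> R) :
  hist_mean t (fun h => \sum_(k <- r) F k h) = \sum_(k <- r) hist_mean t (F k).
Proof.
elim: r => [|k r IHr].
  rewrite big_nil -[RHS](hist_mean_cst t 0).
  by apply: eq_hist_mean => h _ _; rewrite big_nil.
rewrite big_cons -IHr -hist_meanD.
by apply: eq_hist_mean => h _ _; rewrite big_cons.
Qed.

Lemma hist_mean_supermartingale t f :
  (forall h, next_mean f h <= f h) -> hist_mean t f <= f [::].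
Proof.
move=> sup; elim: t => [//|t IHt] /=; apply: le_trans IHt.
by apply: ler_hist_mean => h _ _.
Qed.

(** ** Additive functionals up to the stopping time *)

(** The event that step size h, counted from 0, takes place. *)
Definition alive h : bool :=
  all (fun n => ~~ stop S (take n h)) (iota 1 (size h)).

Lemma alive_rcons h x : alive (rcons h x) = alive h && ~~ stop S (rcons h x).
Proof.
rewrite /alive size_rcons -(addn1 (size h)) iotaD all_cat add1n /= andbT.
congr (_ && ~~ stop S _); last by rewrite -(size_rcons h x) take_size.
apply/eq_in_all => n; rewrite mem_iota add1n ltnS => /andP[_ nh].
by rewrite -cats1 takel_cat.
Qed.

(** The step at whose end the test stops is included. *)
Definition until_stop (c : history M -> 'I_M * bool -> R) h : R :=
  \sum_(n < size h)
    (alive (take n h))%:R * c (take n h) (nth (Ordinal M_gt0, false) h n).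

Lemma until_stop_rcons c h x :
  until_stop c (rcons h x) = until_stop c h + (alive h)%:R * c h x.
Proof.
rewrite /until_stop size_rcons big_ord_recr /=; congr (_ + _).
  apply: eq_bigr => n _; rewrite -cats1 takel_cat; last exact: ltnW.
  by rewrite nth_cat ltn_ord.
by rewrite -cats1 takel_cat // take_size nth_cat ltnn subnn.
Qed.

Lemma until_stop0 c : until_stop c [::] = 0.
Proof. by rewrite /until_stop big_ord0. Qed.

Lemma hist_mean_until_stop c t : hist_mean t (until_stop c) =
  \sum_(n < t) hist_mean n (fun h => (alive h)%:R *
     (q (search h) * c h (search h, true) + (1 - q (search h)) * c h (search h, false))).
Proof.
elim: t => [|t IHt]; first by rewrite big_ord0 /= until_stop0.
rewrite big_ord_recr -IHt /= -hist_meanD; apply: eq_hist_mean => h _ _.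
by rewrite /next_mean !until_stop_rcons; ring.
Qed.

Lemma ler_until_stop (c c' : history M -> 'I_M * bool -> R) h :
  reachable h -> (forall g z, reachable g -> c g (search g, z) <= c' g (search g, z)) ->
  until_stop c h <= until_stop c' h.
Proof.
move=> rh cc; elim: rh => [|{}h z rh IHh]; first by rewrite !until_stop0.
by rewrite !until_stop_rcons lerD // ler_wpM2l // cc.
Qed.

Lemma until_stopD c (c' : history M -> 'I_M * bool -> R) h :
  until_stop (fun g x => c g x + c' g x) h = until_stop c h + until_stop c' h.
Proof. by rewrite /until_stop -big_split; apply: eq_bigr => n _; rewrite mulrDr. Qed.

Lemma until_stopZ k c h :
  until_stop (fun g x => k * c g x) h = k * until_stop c h.
Proof. by rewrite /until_stop mulr_sumr; apply: eq_bigr => n _; rewrite mulrCA. Qed.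

Lemma until_stop_ge0 c h : (forall g x, 0 <= c g x) -> 0 <= until_stop c h.
Proof. by move=> c0; apply: sumr_ge0 => n _; rewrite mulr_ge0. Qed.

(** ** Error scores as random walks with negative drift *)

Variables (i : option 'I_M) (eps : R).
Definition wrong_prob u : R := if i == Some u then 1 - q u else q u.
Hypothesis wrong_le : forall u, wrong_prob u <= eps.
Local Notation err := (err_score i).

Let wrong_ge0 u : 0 <= wrong_prob u.
Proof. by rewrite /wrong_prob; case: ifP. Qed.

Let eps_ge0 : 0 <= eps.
Proof. exact: le_trans (wrong_ge0 (Ordinal M_gt0)) (wrong_le _). Qed.

Lemma next_meanE f h : next_mean f h =
  wrong_prob (search h) * f (rcons h (search h, i != Some (search h))) +
  (1 - wrong_prob (search h)) * f (rcons h (search h, i == Some (search h))).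
Proof. by rewrite /next_mean /wrong_prob; case: eqP => _ /=; ring. Qed.

Lemma wrong_step u : wrong i (u, i != Some u) = true /\ wrong i (u, i == Some u) = false.
Proof. by rewrite /wrong /=; case: (i == Some u). Qed.

(** The exponential of the walk contracts by the factor phi whenever u is
    searched; visits compensate this. *)
Lemma err_score_drift (lam phi : R) u h : 0 <= lam ->
  eps * expR lam + (1 - eps) * expR (- lam) <= phi -> 0 < phi ->
  next_mean (fun g => expR (lam * (err g u)%:~R) / phi ^+ count (fun x => x.1 == u) g) h <=
  expR (lam * (err h u)%:~R) / phi ^+ count (fun x => x.1 == u) h.
Proof.
move=> lam0 rate phi0; rewrite next_meanE; cbv beta.
have [w1 w0] := wrong_step (search h).
rewrite !err_score_rcons -!cats1 !count_cat /= w1 w0 !addn0.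
set e := err h u; set n := count _ h; set p := wrong_prob _.
case: eqP => _; last by rewrite addr0 addn0 -mulrDl addrC subrK mul1r.
rewrite addn1 !rmorphD /= rmorphN /= mulr1z !mulrDr mulr1 mulrN1 !expRD exprS invfM.
have -> : p * (expR (lam * e%:~R) * expR lam * (phi^-1 * phi ^- n)) +
    (1 - p) * (expR (lam * e%:~R) * expR (- lam) * (phi^-1 * phi ^- n)) =
    (p * expR lam + (1 - p) * expR (- lam)) / phi * (expR (lam * e%:~R) * phi ^- n).
  by ring.
rewrite -[leRHS]mul1r; apply: ler_wpM2r.
  by rewrite mulr_ge0 ?expR_ge0 // invr_ge0 exprn_ge0 // ltW.
rewrite ler_pdivrMr // mul1r; apply: le_trans rate.
have pe : p <= eps := wrong_le _.
have ll : expR (- lam) <= expR lam by rewrite ler_expR; lra.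
by nra.
Qed.

Lemma err_score_tail (lam phi k : R) u t J : 0 <= lam ->
  eps * expR lam + (1 - eps) * expR (- lam) <= phi -> 0 < phi -> phi <= 1 ->
  (forall h, reachable h -> size h = t -> (J <= count (fun x => x.1 == u) h)%N) ->
  hist_mean t (fun h => (- k <= (err h u)%:~R)%R%:R) <= expR (lam * k) * phi ^+ J.
Proof.
move=> lam0 rate phi0 phi1 visits.
pose V g := expR (lam * (err g u)%:~R) / phi ^+ count (fun x : 'I_M * bool => x.1 == u) g.
apply: (@le_trans _ _ (hist_mean t (fun h => (expR (lam * k) * phi ^+ J) * V h))).
  apply: ler_hist_mean => h rh ht.
  have V0 : 0 <= V h by rewrite divr_ge0 ?expR_ge0 ?exprn_ge0 // ltW.
  have C0 : 0 <= expR (lam * k) * phi ^+ J.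
    by rewrite mulr_ge0 ?expR_ge0 ?exprn_ge0 // ltW.
  have [ke|ke] := leP (- k) (err h u)%:~R; last exact: mulr_ge0.
  rewrite /V mulrACA -expRD -[leLHS]mulr1; apply: ler_pM => //.
    by rewrite -[leLHS]expR0 ler_expR -mulrDr mulr_ge0 //; lra.
  rewrite ler_pdivlMr ?exprn_gt0 // mul1r.
  by apply: ler_wiXn2l; rewrite ?visits // ltW.
rewrite hist_meanZ -[leRHS]mulr1; apply: ler_wpM2l.
  by rewrite mulr_ge0 ?expR_ge0 ?exprn_ge0 // ltW.
have -> : 1 = V [::].
  by rewrite /V /err_score /score /= subrr oppr0 if_same mulr0z mulr0 expR0 divr1.
by apply: hist_mean_supermartingale => h; apply: err_score_drift.
Qed.

Definition ever_above (k : R) u h : bool :=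
  has (fun n => k < (err (take n h) u)%:~R) (iota 0 (size h).+1).

Lemma ever_above_rcons k u h x :
  ever_above k u (rcons h x) = ever_above k u h || (k < (err (rcons h x) u)%:~R).
Proof.
rewrite /ever_above size_rcons.
have -> : iota 0 (size h).+2 = rcons (iota 0 (size h).+1) (size h).+1.
  by rewrite -cats1 -addn1 iotaD.
rewrite has_rcons orbC (_ : take (size h).+1 (rcons h x) = rcons h x); last first.
  by rewrite -(size_rcons h x) take_size.
congr (_ || _); apply/eq_in_has => n; rewrite mem_iota add0n ltnS => nh.
by rewrite -cats1 takel_cat.
Qed.

(** Maximal inequality for the supermartingale expR (lam * err), with the value of
    the process frozen to 1 once the level has been exceeded. *)
Lemma ever_above_le (lam k : R) u t : 0 <= lam -> 0 <= k ->
  eps * expR lam + (1 - eps) * expR (- lam) <= 1 ->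
  hist_mean t (fun h => (ever_above k u h)%:R) <= expR (- (lam * k)).
Proof.
move=> lam0 k0 rate.
pose E g := expR (lam * (err g u)%:~R) / 1 ^+ count (fun x : 'I_M * bool => x.1 == u) g.
pose V g := if ever_above k u g then 1 else expR (- (lam * k)) * E g.
have E0 g : 0 <= E g by rewrite divr_ge0 ?expR_ge0 ?exprn_ge0.
have V0 g : 0 <= V g by rewrite /V; case: ifP => // _; rewrite mulr_ge0 ?expR_ge0.
apply: (@le_trans _ _ (hist_mean t V)).
  apply: ler_hist_mean => h _ _; rewrite /V; case: ifP => // _.
  by rewrite mulr_ge0 ?expR_ge0.
have err0 : err [::] u = 0.
  by rewrite /err_score /score /= subrr oppr0 if_same.
have -> : expR (- (lam * k)) = V [::].
  rewrite /V /ever_above /= err0 mulr0z ltNge k0 /=.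
  by rewrite /E err0 mulr0z mulr0 expR0 expr1n divr1 mulr1.
apply: hist_mean_supermartingale => h.
rewrite {2}/V; case: ifP => above.
  by rewrite /next_mean /V !ever_above_rcons above /= !mulr1 addrC subrK.
have VE x : V (rcons h x) <= expR (- (lam * k)) * E (rcons h x).
  rewrite /V ever_above_rcons above /=; case: ifP => // kx.
  rewrite /E expr1n divr1 -expRD -[leLHS]expR0 ler_expR -mulrN -mulrDr mulr_ge0 //.
  by rewrite addrC subr_ge0 ltW.
apply: (@le_trans _ _ (expR (- (lam * k)) * next_mean E h)).
  rewrite /next_mean mulrDr mulrCA [X in _ <= _ + X]mulrCA.
  by apply: lerD; apply: ler_wpM2l.
by rewrite ler_pM2l ?expR_gt0 //; apply: err_score_drift.
Qed.

End HistoryMean.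

(** * Forced exploration *)

Section Exploration.
Variables (R : realType) (b : R).
Hypothesis b_gt0 : 0 < b.

Definition explore_time (k : nat) : nat := Num.truncn (expR (b * k%:R)).

Let expR_gt1 k : 1 <= expR (b * k%:R).
Proof. by rewrite -[leLHS]expR0 ler_expR mulr_ge0 // ltW. Qed.

Lemma explore_time_mono k k' : (k <= k')%N -> (explore_time k <= explore_time k')%N.
Proof. by move=> kk'; rewrite le_truncn // ler_expR ler_pM2l // ler_nat. Qed.

Lemma explore_time_leP k n : ((explore_time k <= n)%N) = (expR (b * k%:R) < n.+1%:R).
Proof. exact: truncn_le_nat. Qed.

(** Rounding identifies exploration times only as long as the gaps of the
    geometric sequence are below 1. *)
Definition explore_start : nat := (Num.truncn (b * b)^-1).+1.

Lemma explore_time_strict k : (explore_start <= k)%N ->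
  (explore_time k < explore_time k.+1)%N.
Proof.
move=> k0k.
rewrite truncn_ge_nat ?expR_ge0 //.
have kb : 1 <= b * k%:R * b.
  have : (b * b)^-1 <= k%:R.
    by apply: ltW; apply: lt_le_trans (truncnS_gt _) _; rewrite ler_nat.
  by rewrite -div1r ler_pdivrMr ?mulr_gt0 //; nra.
have e1 := expR_ge1Dx (b * k%:R); have e2 := expR_ge1Dx b.
have tk : (explore_time k)%:R <= expR (b * k%:R) by rewrite truncn_le expR_ge0.
rewrite -natr1 -[k.+1%:R]natr1 mulrDr mulr1 expRD; apply: le_trans (lerD tk (lexx 1)) _.
move: (expR_gt1 k) e1 e2 kb; move: (b * k%:R) => x; move: (expR x) (expR b) => E F E1 Ex Fb xb.
have : 0 <= E * (F - (1 + b)).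
  by rewrite mulr_ge0 ?subr_ge0 //; apply: le_trans E1.
have : 0 <= (E - (1 + x)) * b by rewrite mulr_ge0 ?subr_ge0 // ltW.
by move=> {tk}; nra.
Qed.

Variable schd : nat -> option nat.
Hypothesis schdP : exploration_schedule b schd.

Lemma schedule_explore_time k : (explore_start < k)%N ->
  schd (explore_time k) = Some k.
Proof.
move=> k0k.
have mono k1 k2 : (explore_start <= k1)%N -> (k1 < k2)%N ->
    (explore_time k1 < explore_time k2)%N.
  move=> k01 k12; apply: leq_trans (explore_time_strict k01) _.
  exact: explore_time_mono.
have := schdP (explore_time k); case: schd => [k'|/(_ k) //] eqt.
congr Some; apply/eqP; rewrite eqn_leq; apply/andP; split; rewrite leqNgt; apply/negP => lt.
  by have := mono k k' (ltnW k0k) lt; rewrite [in leqRHS]/explore_time -eqt ltnn.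
have kpos : (0 < k)%N by apply: leq_ltn_trans k0k.
have : (explore_time k' < explore_time k)%N.
  apply: (@leq_ltn_trans (explore_time k.-1)).
    by apply: explore_time_mono; rewrite -ltnS prednK.
  by apply: mono; rewrite ?prednK // -ltnS prednK.
by rewrite [X in (X < _)%N]/explore_time -eqt ltnn.
Qed.

Lemma exploration_count m :
  \sum_(s < m) (schd s.+1 != None)%:R <= 1 + ln (m%:R + 1) / b :> R.
Proof.
rewrite -natr_sum (_ : (\sum_(s < m) (schd s.+1 != None))%N =
  #|[set s : 'I_m | schd s.+1 != None]%SET|); last first.
  rewrite -sum1dep_card [RHS]big_mkcond /=.
  by apply: eq_bigr => s _; case: schd.
pose K := Num.truncn (ln (m%:R + 1 : R) / b).
have m1 : 0 < m%:R + 1 :> R by rewrite ltr_wpDl.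
have lnm : 0 <= ln (m%:R + 1 : R) by rewrite ln_ge0 // lerDr.
have schd_lt (s : 'I_m) k : schd s.+1 = Some k -> s.+1 = explore_time k /\ (k < K.+1)%N.
  move=> sk; have := schdP s.+1; rewrite sk => sE; split=> //.
  have : (explore_time k <= m)%N by rewrite /explore_time -sE.
  rewrite explore_time_leP -natr1 => lt.
  have lb : 0 <= ln (m%:R + 1 : R) / b by rewrite divr_ge0 // ltW.
  rewrite ltnS /K truncn_ge_nat // ler_pdivlMr // mulrC.
  by rewrite -ler_expR lnK ?posrE // ltW.
apply: (@le_trans _ _ K.+1%:R); last first.
  by rewrite -natr1 addrC lerD2l truncn_le divr_ge0 // ltW.
rewrite ler_nat -[leqRHS]card_ord.
pose f (s : 'I_m) : 'I_K.+1 := inord (odflt 0 (schd s.+1)).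
rewrite -(@card_in_imset _ _ f); first by rewrite max_card.
move=> s1 s2; rewrite !inE.
case E1: (schd s1.+1) => [k1|] // _; case E2: (schd s2.+1) => [k2|] // _.
have [t1 lt1] := schd_lt _ _ E1; have [t2 lt2] := schd_lt _ _ E2.
rewrite /f E1 E2 => /(congr1 val); rewrite /= !inordK // => k12.
by apply/val_inj; apply: succn_inj; rewrite t1 t2 k12.
Qed.

End Exploration.

Section ExplorationVisits.
Variables (R : realType) (Y : finType) (M : nat) (M_gt0 : (0 < M)%N) (b : R).
Hypothesis b_gt0 : 0 < b.

(** Any M consecutive indices k visit every location once, and M indices later the
    exploration time has grown by the factor expR (b * M) <= B. *)
Lemma exploration_visits : exists B k1 : nat, (1 < B)%N /\
  forall S : test R Y M, exploration_schedule b (sched S) ->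
  forall h u J, reachable M_gt0 S h -> (B ^ (J + k1) <= size h)%N ->
  (J <= count (fun x => x.1 == u) h)%N.
Proof.
pose k0 := explore_start b.
pose B := (Num.truncn (expR (b * M%:R))).+2.
have eB : expR (b * M%:R) <= B%:R.
  by apply: ltW; apply: lt_trans (truncnS_gt _) _; rewrite ltr_nat.
exists B, k0.+1; split=> // S schdP h u J rh Jh.
pose k j := ((j + k0.+1) * M + u)%N.
have k0k j : (k0 < k j)%N.
  apply: leq_trans (leq_addr u _); apply: leq_trans (leq_pmulr _ M_gt0).
  exact: leq_addl.
have locE j : cyclic_loc M_gt0 (k j) = u.
  by apply/val_inj; rewrite /= /k modnMDl modn_small.
have visits h' j : reachable M_gt0 S h' ->
    (forall j', (j' < j)%N -> (explore_time b (k j') <= size h')%N) ->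
    (j <= count (fun x => x.1 == u) h')%N.
  elim: j h' => [//|j IHj] h' rh' le.
  have t_gt0 : (0 < explore_time b (k j))%N.
    have kpos : (0 < k j)%N := leq_ltn_trans (leq0n _) (k0k j).
    have k1 : (explore_start b <= (k j).-1)%N by rewrite -ltnS prednK // k0k.
    rewrite -(prednK kpos); exact: leq_ltn_trans (leq0n _) (explore_time_strict b_gt0 k1).
  pose n := (explore_time b (k j)).-1.
  have nE : n.+1 = explore_time b (k j) by rewrite prednK.
  have tn : (n < size h')%N by rewrite nE le.
  have [rn locn] := reachable_prefix rh' tn.
  rewrite -(cat_take_drop n h') count_cat (drop_nth (u, false)) //= locn.
  rewrite /search size_takel ?(ltnW tn) // nE schedule_explore_time //.
  rewrite locE eqxx add1n addnS ltnS; apply: leq_trans (leq_addr _ _).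
  apply: IHj => // j' jj'; rewrite size_takel ?(ltnW tn) // -ltnS nE.
  have : (k j' < k j)%N by rewrite /k ltn_add2r ltn_pmul2r // ltn_add2r.
  move=> /(explore_time_mono b_gt0); apply: leq_trans.
  exact/explore_time_strict/ltnW.
apply: visits => // j jJ; apply: leq_trans Jh.
apply: (@leq_trans (B ^ (j + k0.+2))); last first.
  by rewrite leq_exp2l // -addSnnS leq_add2r.
rewrite explore_time_leP; apply: (@le_lt_trans _ _ (B ^ (j + k0.+2))%:R); last by rewrite ltr_nat.
rewrite natrX; apply: le_trans (_ : expR (b * M%:R) ^+ (j + k0.+2) <= _); last first.
  by apply: lerXn2r => //; rewrite nnegrE // expR_ge0.
rewrite -expRM_natl ler_expR mulrCA ler_pM2l // -natrM ler_nat.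
by rewrite /k; have := ltn_ord u; nia.
Qed.

End ExplorationVisits.

(** * Expected cost and error probability of the outer test *)

(** Grouped by exploration rounds, the sum is dominated by a geometric series: a
    round is B times as long as the previous one, while the bound on P is divided
    by 2 B. *)
Lemma sum_exploration_tail (R : realType) (B k1 n : nat) (P : nat -> R) :
  (1 < B)%N -> (forall t, 0 <= P t) -> (forall t, P t <= 1) ->
  (forall J t, (B ^ (J + k1) <= t)%N -> P t <= (2 * B%:R)^-1 ^+ J) ->
  \sum_(t < n) P t <= B%:R ^+ k1 + 2 * B%:R ^+ k1.+1.
Proof.
move=> B1 P0 P1 PJ.
have B0 : 0 < B%:R :> R by rewrite ltr0n ltnW.
have main J : \sum_(t < B ^ (J + k1)) P t <=
    B%:R ^+ k1 + 2 * B%:R ^+ k1.+1 * (1 - 2^-1 ^+ J).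
  elim: J => [|J IHJ].
    rewrite expr0 subrr mulr0 addr0.
    apply: (@le_trans _ _ (\sum_(t < B ^ (0 + k1)) 1)); first exact: ler_sum.
    by rewrite sumr_const card_ord natrX.
  rewrite addSn -(big_mkord predT) (@big_cat_nat _ _ _ (B ^ (J + k1))%N) //=; last first.
    by rewrite leq_exp2l // addSn.
  rewrite big_mkord; apply: le_trans (lerD IHJ (_ : _ <= B%:R ^+ k1.+1 * 2^-1 ^+ J)) _.
    apply: (@le_trans _ _ (\sum_(B ^ (J + k1) <= t < B ^ (J + k1).+1) (2 * B%:R)^-1 ^+ J)).
      by rewrite big_nat [leRHS]big_nat; apply: ler_sum => t /andP[tJ _]; apply: PJ.
    rewrite sumr_const_nat -[leLHS]mulr_natl.
    apply: (@le_trans _ _ ((B ^ (J + k1).+1)%:R * (2 * B%:R)^-1 ^+ J)).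
      apply: ler_wpM2r; last by rewrite ler_nat leq_subr.
      by rewrite exprn_ge0 // invr_ge0 mulr_ge0.
    rewrite natrX -addnS exprD invfM exprMn.
    rewrite (_ : _ * _ = B%:R ^+ k1.+1 * 2^-1 ^+ J * (B%:R ^+ J * B%:R^-1 ^+ J)); last by ring.
    by rewrite -exprMn divff ?gt_eqF // expr1n mulr1.
  rewrite [2^-1 ^+ J.+1]exprS le_eqVlt; apply/orP; left; apply/eqP.
  by field.
have nB : (n <= B ^ (n + k1))%N.
  by apply: leq_trans (ltnW (ltn_expl n B1)) _; rewrite leq_exp2l // leq_addr.
apply: (@le_trans _ _ (\sum_(t < B ^ (n + k1)) P t)).
  rewrite -!(big_mkord predT) [leRHS](@big_cat_nat _ _ _ n) //= lerDl.
  exact: sumr_ge0.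
apply: le_trans (main n) _; rewrite lerD2l -[leRHS]mulr1.
by rewrite ler_wpM2l ?gerBl ?exprn_ge0 // mulr_ge0 ?exprn_ge0 // ltW.
Qed.

Section Run.
Variables (R : realType) (Y : finType) (M : nat) (M_gt0 : (0 < M)%N).
Variables (S : test R Y M) (q : 'I_M -> R) (i : option 'I_M) (eps : R).
Hypotheses (q_ge0 : forall u, 0 <= q u) (q_le1 : forall u, q u <= 1).
Hypothesis ruleP : argmax_rule (rule S).
Hypothesis wrong_le : forall u, wrong_prob q i u <= eps.
Hypothesis level_gt2 : 2 < level S.
Variables (B k1 : nat).
Hypotheses (B_gt1 : (1 < B)%N)
  (visitsP : forall h u J, reachable M_gt0 S h -> (B ^ (J + k1) <= size h)%N ->
     (J <= count (fun x => x.1 == u) h)%N).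
Hypothesis eps_small : 16 * B%:R ^+ 2 * eps <= 1.
Implicit Types (h : history M) (u v : 'I_M).
Local Notation K := (margin S).
Local Notation mean := (hist_mean M_gt0 S q).
Local Notation until := (until_stop M_gt0 S).

Let B_gt0 : 0 < B%:R :> R. Proof. by rewrite ltr0n ltnW. Qed.
Let B_ge2 : 2 <= B%:R :> R. Proof. by rewrite ler_nat. Qed.
Let K_ge0 : 0 <= K. Proof. exact: margin_ge0. Qed.

(* exploration rounds grow by the factor B, so a bound divided by 2 B in each round
   is summable over time *)
Let phi : R := (2 * B%:R)^-1.
Let phi_gt0 : 0 < phi. Proof. by rewrite invr_gt0 mulr_gt0. Qed.
Let phi_le : phi <= 2^-1.
Proof. by rewrite lef_pV2 ?posrE ?mulr_gt0 //; move: B_ge2; lra. Qed.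

(* expR lam = 2 / phi makes both eps * expR lam and expR (- lam) at most phi / 2 *)
Let lam : R := ln (4 * B%:R).
Let lam_ge0 : 0 <= lam. Proof. by apply: ln_ge0; move: B_ge2; lra. Qed.

Let wrong_prob_ge0 u : 0 <= wrong_prob q i u.
Proof. by rewrite /wrong_prob; case: ifP => _ //; rewrite subr_ge0. Qed.

Let eps_ge0 : 0 <= eps.
Proof. exact: le_trans (wrong_prob_ge0 (Ordinal M_gt0)) (wrong_le _). Qed.

Let rate : eps * expR lam + (1 - eps) * expR (- lam) <= phi.
Proof.
have B4 : 0 < 4 * B%:R :> R by rewrite mulr_gt0.
rewrite expRN /lam lnK ?posrE //.
have -> : phi = 2 * (4 * B%:R)^-1.
  by rewrite /phi; field; rewrite gt_eqF.
set x := 4 * B%:R; have x0 : 0 < x^-1 by rewrite invr_gt0.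
suff ex : eps * x <= x^-1.
  have : 0 <= eps * x^-1 by rewrite mulr_ge0 // ltW.
  by lra.
rewrite -div1r ler_pdivlMr //; move: eps_small.
by rewrite /x (_ : eps * _ * _ = 16 * B%:R ^+ 2 * eps) //; ring.
Qed.

Lemma err_score_decay k u t J : (B ^ (J + k1) <= t)%N ->
  mean t (fun h => (- k <= (err_score i h u)%:~R)%R%:R) <= expR (lam * k) * phi ^+ J.
Proof.
move=> Jt; apply: (err_score_tail q_ge0 q_le1 wrong_le) => //; last first.
  by move=> h rh ht; apply: visitsP => //; rewrite ht.
by apply: le_trans phi_le _; lra.
Qed.

Lemma wrong_estimate_sum n :
  \sum_(t < n) mean t (fun h => (estimate S h != i)%:R) <=
  M%:R * (B%:R ^+ k1 + 2 * B%:R ^+ k1.+1).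
Proof.
apply: (@le_trans _ _ (\sum_(t < n) \sum_(u < M)
    mean t (fun h => (- (0 : R) <= (err_score i h u)%:~R)%R%:R))).
  apply: ler_sum => t _; rewrite -hist_mean_sum //.
  apply: ler_hist_mean => // h _ _; case: eqP => [_|/eqP ne].
    by rewrite sumr_ge0.
  have [u ue] : exists u, 0 <= err_score i h u.
    apply/existsP; apply: contraNT ne; rewrite negb_exists => /forallP lt.
    by apply/eqP/estimate_correct => // u; rewrite ltNge lt.
  rewrite (bigD1 u) //= oppr0 ler0z ue lerDl; exact: sumr_ge0.
rewrite exchange_big /=.
apply: (@le_trans _ _ (\sum_(u < M) (B%:R ^+ k1 + 2 * B%:R ^+ k1.+1))); last first.
  by rewrite sumr_const card_ord -[leLHS]mulr_natl.
apply: ler_sum => u _.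
pose P t := mean t (fun h => (- (0 : R) <= (err_score i h u)%:~R)%R%:R).
apply: (@sum_exploration_tail _ B k1 n P) => // [t|t|J t Jt].
- by apply: hist_mean_ge0.
- rewrite -[leRHS](hist_mean_cst M_gt0 S q_ge0 q_le1 t); apply: ler_hist_mean => // h _ _.
  by rewrite lern1 leq_b1.
- have := err_score_decay 0 u Jt; by rewrite mulr0 expR0 mul1r.
Qed.

Definition bad_stop h : bool :=
  has (fun n => stop S (take n h) && (estimate S (take n h) != i)) (iota 1 (size h)).

(** A wrong decision requires some error score to exceed the margin, and a run that
    has not stopped by time t an error score that is still above minus the margin;
    the latter has vanishing probability as t grows, hence the arbitrary eta. *)
Lemma error_prob_le (lam' eta : R) : 0 <= lam' ->
  eps * expR lam' + (1 - eps) * expR (- lam') <= 1 -> 0 < eta ->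
  exists2 t : nat, (0 < t)%N &
    mean t (fun h => (bad_stop h || ~~ stop S h)%:R) <=
    M%:R * expR (- (lam' * K)) + eta.
Proof.
move=> lam'0 rate' eta0.
have [J HJ] : exists J, M%:R * (expR (lam * K) * phi ^+ J) <= eta.
  have C0 : 0 < M%:R * expR (lam * K) by rewrite mulr_gt0 ?expR_gt0 ?ltr0n.
  have x0 : 0 < eta / (M%:R * expR (lam * K)) by rewrite divr_gt0.
  exists (Num.truncn (eta / (M%:R * expR (lam * K)))^-1).+1.
  rewrite mulrA -ler_pdivlMl // [leRHS]mulrC.
  set J := (_.+1); apply: (@le_trans _ _ (2^-1 ^+ J)).
    by apply: lerXn2r; rewrite ?nnegrE // ltW.
  rewrite exprVn invf_ple ?posrE ?exprn_gt0 //.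
  apply: ltW; apply: lt_le_trans (truncnS_gt _) _; rewrite -natrX ler_nat ltnW //.
  exact: ltn_expl.
exists (B ^ (J + k1))%N; first by rewrite expn_gt0 ltnW.
set t := (B ^ _)%N.
pose lateP u := mean t (fun h => (- K <= (err_score i h u)%:~R)%R%:R).
pose everP u := mean t (fun h => (ever_above i K u h)%:R).
apply: (@le_trans _ _ (\sum_(u < M) (everP u + lateP u))).
  under [leRHS]eq_bigr do rewrite /everP /lateP -hist_meanD //.
  rewrite -hist_mean_sum //; apply: ler_hist_mean => // h _ _.
  have sum0 u : 0 <= (ever_above i K u h)%:R + (- K <= (err_score i h u)%:~R)%R%:R :> R.
    by rewrite addr_ge0.
  have term_le u : (ever_above i K u h)%:R + (- K <= (err_score i h u)%:~R)%R%:R <=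
      \sum_(u < M) ((ever_above i K u h)%:R + (- K <= (err_score i h u)%:~R)%R%:R) :> R.
    by rewrite [leRHS](bigD1 u) //= lerDl sumr_ge0.
  have [bad|_] := boolP (bad_stop h) => /=.
    have [u above] : exists u, ever_above i K u h.
      move: bad => /hasP[n]; rewrite mem_iota add1n ltnS => /andP[n0 nh] /andP[st ei].
      have [u Ku] := stop_error level_gt2 st ei.
      by exists u; apply/hasP; exists n; rewrite ?mem_iota.
    by apply: le_trans (term_le u); rewrite above lerDl.
  case: (boolP (stop S h)) => [_|ns] /=; first exact: sumr_ge0.
  have [u late] : exists u, - K <= (err_score i h u)%:~R.
    apply/existsP; apply: contraNT ns; rewrite negb_exists => /forallP lt.
    by have [] // := stop_correct ruleP level_gt2 (i := i) (h := h) _ => u; rewrite ltNge lt.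
  by apply: le_trans (term_le u); rewrite late lerDr.
have sumE (x : R) : M%:R * x = \sum_(u < M) x.
  by rewrite sumr_const card_ord mulr_natl.
rewrite big_split /=; apply: lerD.
  rewrite sumE; apply: ler_sum => u _.
  exact: (@ever_above_le _ _ _ M_gt0 S q q_ge0 q_le1 i eps wrong_le).
apply: le_trans HJ; rewrite sumE.
by apply: ler_sum => u _; apply: err_score_decay.
Qed.

End Run.

Section Cost.
Variables (R : realType) (Y : finType) (M : nat) (M_gt0 : (0 < M)%N).
Variables (S : test R Y M) (q : 'I_M -> R) (v : 'I_M) (eps : R) (b : R).
Hypotheses (q_ge0 : forall u, 0 <= q u) (q_le1 : forall u, q u <= 1).
Hypothesis ruleP : argmax_rule (rule S).
Hypothesis wrong_le : forall u, wrong_prob q (Some v) u <= eps.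
Hypothesis level_gt2 : 2 < level S.
Variables (B k1 : nat).
Hypotheses (B_gt1 : (1 < B)%N)
  (visitsP : forall h u J, reachable M_gt0 S h -> (B ^ (J + k1) <= size h)%N ->
     (J <= count (fun x => x.1 == u) h)%N).
Hypothesis eps_small : 16 * B%:R ^+ 2 * eps <= 1.
Hypotheses (b_gt0 : 0 < b) (schdP : exploration_schedule b (sched S)).
Implicit Types (h g : history M) (u : 'I_M) (x : 'I_M * bool).
Local Notation K := (margin S).
Local Notation mean := (hist_mean M_gt0 S q).
Local Notation until := (until_stop M_gt0 S).
Local Notation alive := (alive S).

Let K_ge0 : 0 <= K. Proof. exact: margin_ge0. Qed.

Let duration := until (fun _ _ => 1).
Let target_visits := until (fun _ x => (x.1 == v)%:R).
Let wrong_outputs := until (fun _ x => (wrong (Some v) x)%:R).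
Let explorations := until (fun h _ => (sched S (size h).+1 != None)%:R).
Let wrong_estimates := until (fun h _ => (estimate S h != Some v)%:R).
Let other_visits := until (fun _ x => (x.1 != v)%:R).

(** A right output at v raises both sides by one. A wrong output lowers the score of
    v, or its lead over u, by at most one, while the visit count grows by at most one
    and twice the number of wrong outputs by two. *)
Lemma alive_target_visits g : alive g ->
  target_visits g <= (score g v)%:~R + 2 * wrong_outputs g /\
  forall u, u != v ->
    target_visits g <= (score g v - score g u)%:~R + 2 * wrong_outputs g.
Proof.
elim/last_ind: g => [|g x IHg].
  rewrite /target_visits /wrong_outputs !until_stop0 => _.
  by split=> [|u _]; rewrite (_ : score _ _ = 0) ?subr0 ?mulr0z ?add0r ?mulr0.
rewrite alive_rcons => /andP[ag _]; have [le0 leu] := IHg ag.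
rewrite /target_visits /wrong_outputs !until_stop_rcons ag !mul1r.
rewrite -/(target_visits g) -/(wrong_outputs g) /wrong (inj_eq Some_inj).
split=> [|u uv].
  rewrite score_rcons [v == _]eq_sym; move: le0.
  by case: (x.1 == v); case: x.2; rewrite /= !rmorphD /= ?rmorphN /=; lra.
rewrite !score_rcons [v == _]eq_sym.
have := leu u uv; rewrite !rmorphB /= !rmorphD /=.
have [xv|xv] := eqVneq x.1 v.
  have -> : (x.1 == u) = false by rewrite xv eq_sym; apply/negbTE.
  by case: x.2; rewrite /= ?rmorphN /=; lra.
by case: (x.1 == u); case: x.2; rewrite /= ?rmorphN /=; lra.
Qed.

(** As long as the test goes on, the margin bounds the score of the target or its
    lead over some location; the term 1 is for the step at which it stops. *)
Lemma target_visits_le h : target_visits h <= 1 + K + 2 * wrong_outputs h.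
Proof.
have W0 g : 0 <= wrong_outputs g by apply: until_stop_ge0.
elim/last_ind: h => [|g x IHg].
  rewrite /target_visits until_stop0; have := W0 [::].
  by move: K_ge0; lra.
rewrite /target_visits /wrong_outputs !until_stop_rcons.
rewrite -/(target_visits g) -/(wrong_outputs g).
case ag: (alive g); last by rewrite !mul0r !addr0.
rewrite !mul1r.
have gK : target_visits g <= K + 2 * wrong_outputs g.
  have [le0 leu] := alive_target_visits ag.
  case: (lastP g) ag le0 leu => [_ le0 _|g' y ag le0 leu].
    apply: le_trans le0 _; rewrite (_ : score _ _ = 0) // mulr0z add0r.
    by rewrite lerDr.
  have ns : ~~ stop S (rcons g' y) by move: ag; rewrite alive_rcons => /andP[].
  have [sK|[u uv sK]] := not_stop_score ruleP v level_gt2 ns.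
    by apply: le_trans le0 _; rewrite lerD2r.
  by apply: le_trans (leu u uv) _; rewrite lerD2r.
have : (x.1 == v)%:R <= 1 :> R by rewrite lern1 leq_b1.
have : 0 <= (wrong (Some v) x)%:R :> R by [].
by move: gK; lra.
Qed.

Lemma other_visits_le h : reachable M_gt0 S h ->
  other_visits h <= explorations h + wrong_estimates h.
Proof.
move=> rh; rewrite -until_stopD; apply: ler_until_stop => // g z rg.
rewrite /search; case: (sched S _) => [k|] /=.
  by rewrite -natrD ler_nat; case: eqP => //=.
case: (estimate S g) => [w|] /=.
  by rewrite add0r (inj_eq Some_inj).
by rewrite add0r lern1 leq_b1.
Qed.

Lemma durationE h : duration h = target_visits h + other_visits h.
Proof.
rewrite -until_stopD /duration /until_stop; apply: eq_bigr => n _.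
by congr (_ * _); case: eqP; rewrite ?addr0 ?add0r.
Qed.

Lemma explorationsE h : exists m : nat, [/\ duration h = m%:R,
  explorations h = \sum_(s < m) (sched S s.+1 != None)%:R & alive h -> m = size h].
Proof.
elim/last_ind: h => [|g x [m [dm em am]]].
  by exists 0%N; rewrite /duration /explorations !until_stop0 big_ord0.
rewrite /duration /explorations !until_stop_rcons -/(duration g) -/(explorations g).
rewrite dm em alive_rcons; case ag: (alive g); last first.
  by exists m; rewrite !mul0r !addr0.
have mE := am ag; exists m.+1; rewrite !mul1r natr1 big_ord_recr /= -mE size_rcons.
by split=> // _; rewrite mE.
Qed.

(** The logarithm of the duration is bounded by its tangent at r, so that only the
    mean duration matters after integration. *)
Lemma explorations_le r h : 0 < r ->
  explorations h <= 1 + (ln r + (duration h + 1) / r) / b.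
Proof.
move=> r0; have [m [dm -> _]] := explorationsE h; rewrite dm.
apply: le_trans (exploration_count b_gt0 schdP m) _.
rewrite lerD2l ler_pM2r ?invr_gt0 //.
have m1 : 0 < m%:R + 1 :> R by rewrite ltr_wpDl.
have := ln_leB1 (divr_gt0 m1 r0); rewrite ln_div ?posrE //.
by lra.
Qed.

Lemma mean_wrong_outputs n : mean n wrong_outputs <= eps * mean n duration.
Proof.
rewrite /wrong_outputs /duration !hist_mean_until_stop // mulr_sumr.
apply: ler_sum => t _; rewrite -hist_meanZ //; apply: ler_hist_mean => // h _ _.
rewrite mulrCA; apply: ler_wpM2l => //.
rewrite !mulr1 addrCA subrr addr0 mulr1.
have := wrong_le (search M_gt0 S h); rewrite /wrong_prob /wrong /=.
by case: eqP => _ /=; rewrite ?mulr1 ?mulr0 ?addr0 ?add0r.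
Qed.

Lemma mean_wrong_estimates n : mean n wrong_estimates <=
  M%:R * (B%:R ^+ k1 + 2 * B%:R ^+ k1.+1).
Proof.
apply: le_trans (wrong_estimate_sum q_ge0 q_le1 ruleP wrong_le B_gt1 visitsP eps_small n).
rewrite /wrong_estimates hist_mean_until_stop //; apply: ler_sum => t _.
apply: ler_hist_mean => // h _ _; rewrite -mulrDl addrC subrK mul1r.
by case: (alive h); rewrite ?mul1r ?mul0r.
Qed.

Definition wait_cst : R := M%:R * (B%:R ^+ k1 + 2 * B%:R ^+ k1.+1).
Definition dur_cst : R := wait_cst + 2 + 4 / b ^+ 2.
Definition cost_cst : R := wait_cst + 1 + 4 * (1 + dur_cst) + (3 + 2 * dur_cst) / b.

Let wait_ge0 : 0 <= wait_cst.
Proof. by rewrite mulr_ge0 // addr_ge0 ?mulr_ge0 ?exprn_ge0. Qed.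
Let dur_ge0 : 0 <= dur_cst.
Proof. by rewrite !addr_ge0 // divr_ge0 ?sqr_ge0. Qed.

Lemma cost_cst_ge0 : 0 <= cost_cst.
Proof.
have w := wait_ge0; have dc := dur_ge0; have b1 : 0 <= (3 + 2 * dur_cst) / b.
  by rewrite divr_ge0 ?(ltW b_gt0) // addr_ge0 // mulr_ge0.
by rewrite /cost_cst; lra.
Qed.

Let eps_ge0 : 0 <= eps.
Proof.
apply: le_trans (wrong_le (Ordinal M_gt0)).
by rewrite /wrong_prob; case: ifP => _ //; rewrite subr_ge0.
Qed.

Let eps_le : eps <= 64^-1.
Proof.
have B2 : 2 <= B%:R :> R by rewrite ler_nat.
have B4 : 4 <= B%:R ^+ 2 :> R by rewrite expr2; nra.
have : 0 <= eps * (B%:R ^+ 2 - 4) by rewrite mulr_ge0 // subr_ge0.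
by move: eps_small; lra.
Qed.

(** The bounds on the two kinds of visits involve the mean duration, which is their
    sum. With the tangent point r = 4 / b they absorb it and give a duration of order
    1 + K; feeding this back with r = K + 1 leaves only ln (K + 1) / b. *)
Lemma mean_visits n :
  mean n target_visits <= (1 + K) * (1 + cost_cst * eps) /\
  mean n other_visits <= cost_cst + ln (K + 1) / b.
Proof.
set A := mean n duration; set N := mean n target_visits; set X := mean n other_visits.
have AE : A = N + X.
  by rewrite /A /N /X -hist_meanD //; apply: eq_hist_mean => // h _ _; apply: durationE.
have NA : N <= 1 + K + 2 * (eps * A).
  apply: (@le_trans _ _ (mean n (fun h => (1 + K) + 2 * wrong_outputs h))).
    by apply: ler_hist_mean => // h _ _; apply: target_visits_le.
  rewrite hist_meanD // hist_mean_cst // hist_meanZ // lerD2l ler_pM2l //.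
  exact: mean_wrong_outputs.
have XA r : 0 < r -> X <= wait_cst + 1 + (ln r + (A + 1) / r) / b.
  move=> r0; have [k kE] : exists k, k = 1 + (ln r + 1 / r) / b by eexists.
  apply: (@le_trans _ _ (mean n (fun h => wrong_estimates h +
      (k + (r * b)^-1 * duration h)))).
    apply: ler_hist_mean => // h rh _; apply: le_trans (other_visits_le rh) _.
    rewrite addrC lerD2l; apply: le_trans (explorations_le h r0) _.
    by rewrite kE le_eqVlt; apply/orP; left; apply/eqP; field; rewrite !gt_eqF.
  rewrite !hist_meanD // hist_mean_cst // hist_meanZ // -/A.
  have := mean_wrong_estimates n; rewrite -/wait_cst => W.
  apply: le_trans (lerD W (lexx _)) _.
  by rewrite kE le_eqVlt; apply/orP; left; apply/eqP; field; rewrite !gt_eqF.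
have A0 : 0 <= A by apply: hist_mean_ge0 => // h; apply: until_stop_ge0.
have A_le : A <= 2 * (1 + K + dur_cst).
  have X1 : X <= dur_cst + A / 4.
    have r0 : 0 < 4 / b by rewrite divr_gt0.
    apply: le_trans (XA _ r0) _.
    have e1 : (A + 1) / (4 / b) / b = (A + 1) / 4 by field; rewrite gt_eqF.
    have e2 : ln (4 / b) / b <= 4 / b ^+ 2.
      rewrite expr2 invfM mulrA ler_pM2r ?invr_gt0 //.
      by apply: le_trans (ln_leB1 r0) _; rewrite gerBl.
    by rewrite /dur_cst [(_ + _) / b]mulrDl e1; move: e2; lra.
  have eA : eps * A <= 64^-1 * A by apply: ler_wpM2r.
  by move: NA X1; rewrite AE in eA A0 *; lra.
have K1 : 0 < K + 1 by rewrite ltr_wpDl.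
split.
  have eA : eps * A <= eps * (2 * (1 + K + dur_cst)) by apply: ler_wpM2l.
  apply: le_trans NA _; rewrite mulrDr mulr1 lerD2l.
  apply: (@le_trans _ _ (2 * (eps * (2 * (1 + K + dur_cst))))); first by rewrite ler_pM2l.
  have c1 : 4 * (1 + dur_cst) <= cost_cst.
    have d3 : 0 <= (3 + 2 * dur_cst) / b.
      by rewrite divr_ge0 ?ltW // ltr_wpDr // mulr_ge0.
    by rewrite /cost_cst; move: wait_ge0; lra.
  have : 0 <= eps * (1 + K) * (cost_cst - 4 * (1 + dur_cst)).
    by rewrite !mulr_ge0 // ?subr_ge0 // addr_ge0.
  have : 0 <= eps * (dur_cst * K) := mulr_ge0 eps_ge0 (mulr_ge0 dur_ge0 K_ge0).
  by nra.
apply: le_trans (XA _ K1) _.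
rewrite [(_ + _) / b]mulrDl.
have : (A + 1) / (K + 1) <= 3 + 2 * dur_cst.
  by rewrite ler_pdivrMr //; have := mulr_ge0 dur_ge0 K_ge0; move: K_ge0; nra.
move/(ler_wpM2r (ltW (_ : 0 < b^-1))); rewrite invr_gt0 => /(_ b_gt0).
by rewrite /cost_cst; move: dur_ge0; lra.
Qed.

Lemma run_cost_le (c kappa : R) (cost : 'I_M -> R) n : 0 <= c -> 0 <= kappa ->
  (forall u, cost u <= if u == v then c else kappa) ->
  \sum_(t < n) mean t (fun h => (alive h)%:R * cost (search M_gt0 S h)) <=
  c * ((1 + K) * (1 + cost_cst * eps)) + kappa * (cost_cst + ln (K + 1) / b).
Proof.
move=> c0 kappa0 costP; have [N X] := mean_visits n.
apply: (@le_trans _ _ (mean n (fun h => c * target_visits h + kappa * other_visits h))).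
  rewrite -[leLHS](_ : mean n (until (fun _ x => cost x.1)) = _); last first.
    rewrite hist_mean_until_stop //; apply: eq_bigr => t _.
    by apply: eq_hist_mean => // h _ _; rewrite -mulrDl addrC subrK mul1r.
  apply: ler_hist_mean => // h rh _; rewrite -!until_stopZ -until_stopD.
  apply: ler_until_stop => // g z _ /=; apply: le_trans (costP _) _.
  by case: eqP => _; rewrite ?mulr1 ?mulr0 ?addr0 ?add0r.
rewrite hist_meanD // !hist_meanZ //.
by apply: lerD; apply: ler_wpM2l.
Qed.

End Cost.

(** * From the observation process to outcome histories *)

Lemma integral_partition d (T : measurableType d) (R : realType)
    (P : {measure set T -> \bar R}) (X : finType) (g : T -> X) (A : set T)
    (f : T -> \bar R) :
  measurable A -> (forall x, measurable (g @^-1` [set x])) ->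
  measurable_fun setT f -> (forall w, (0 <= f w)%E) ->
  (\int[P]_(w in A) f w = \sum_x \int[P]_(w in A `&` g @^-1` [set x]) f w)%E.
Proof.
move=> mA mg mf f0; rewrite integral_mkcond.
under eq_bigr do rewrite integral_mkcond.
rewrite -ge0_integral_sum //; last 2 first.
- by move=> x; apply/(measurable_restrictT f (measurableI _ _ mA (mg x))); apply: measurable_funTS.
- by move=> x w _; rewrite patchE; case: ifP.
apply: eq_integral => w _; rewrite (bigD1 (g w)) //= big1 => [|x xg].
  rewrite adde0 !patchE; suff -> : (w \in A `&` g @^-1` [set g w]) = (w \in A) by [].
  by apply/idP/idP; rewrite !inE /=; [case|].
rewrite patchE ifF //; apply/negbTE; rewrite notin_setE /= => -[_ xE].
by move: xg; rewrite xE eqxx.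
Qed.

Lemma measure_partition d (T : measurableType d) (R : realType)
    (P : {measure set T -> \bar R}) (X : finType) (g : T -> X) (A : set T) :
  measurable A -> (forall x, measurable (g @^-1` [set x])) ->
  P A = (\sum_x P (A `&` g @^-1` [set x]))%E.
Proof.
move=> mA mg.
have := integral_partition P mA mg (measurable_cst 1%E) (fun _ => lee01).
rewrite [LHS]integral_cst // mul1e => ->; apply: eq_bigr => x _.
by rewrite [LHS]integral_cst ?mul1e //; apply: measurableI.
Qed.

Section Link.
Variables (R : realType) (Y : finType) (M : nat) (M_gt0 : (0 < M)%N).
Variables (S : test R Y M) (mu : {ffun Y -> R}) (i : option 'I_M) (y0 : Y).
Variables (d : measure_display) (T : measurableType d) (P : probability T R).
Variable obs : nat -> nat -> T -> Y.
Hypothesis level_ge0 : 0 <= level S.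
Hypotheses (mu_pmf : full_pmf mu) (absence_pmf : full_pmf (absence S)).
Hypothesis model : observation_model M_gt0 S mu i P obs.

Local Notation L := (Num.truncn (inner_horizon (test_rho1 S) (level S))).
Local Notation len := (inner_length (absence S) (test_rho1 S) (level S)).
Local Notation out := (inner_output (absence S) (test_rho1 S) (level S)).
Local Notation law := (obs_law S mu i).
Local Notation avg u := (inner_avg y0 (test_rho1 S) (level S) (law u)).
Local Notation search := (search M_gt0 S).
Let path (w : T) : nat -> nat -> Y := fun t n => obs t n w.
Local Notation hist t w := (run_history M_gt0 S (path w) t).

Let law_pmf u : full_pmf (law u).
Proof. by rewrite /obs_law; case: ifP. Qed.

Let law_ge0 u y : 0 <= law u y.
Proof. by have [p0 _] := law_pmf u; apply: ltW. Qed.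

Lemma size_run_history o t : size (run_history M_gt0 S o t) = t.
Proof. by elim: t => //= t IHt; rewrite size_rcons IHt. Qed.

Lemma take_run_history o s t : (s <= t)%N ->
  take s (run_history M_gt0 S o t) = run_history M_gt0 S o s.
Proof.
elim: t => [|t IHt]; first by rewrite leqn0 => /eqP ->.
rewrite leq_eqVlt => /predU1P[->|st].
  by rewrite -{1}(size_run_history o t.+1) take_size.
by rewrite /= -cats1 takel_cat ?size_run_history // IHt.
Qed.

Lemma eq_run_history o o' t :
  (forall s, (s < t)%N -> out (o s) = out (o' s)) ->
  run_history M_gt0 S o t = run_history M_gt0 S o' t.
Proof.
elim: t => [//|t IHt] eo /=; rewrite IHt => [|s st]; last exact/eo/ltnW.
by rewrite /run_output eo.
Qed.

(** ** Events determined by finitely many observations *)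

Definition determined (t : nat) (A : set T) : Prop := forall w w' : T,
  (forall s n, (s < t)%N -> (n < L)%N -> obs s n w = obs s n w') -> A w -> A w'.

Lemma measurable_determined t A : determined t A -> measurable A.
Proof.
move=> dA; have [mobs _] := model.
pose g w : {ffun 'I_t * 'I_L -> Y} := [ffun p : 'I_t * 'I_L => obs p.1 p.2 w].
have mg x : measurable (g @^-1` [set x]).
  rewrite (_ : _ @^-1` _ = \bigcap_(p in [set: 'I_t * 'I_L]) [set w | obs p.1 p.2 w = x p]).
    by apply: fin_bigcap_measurable => // p _; apply: mobs.
  apply/seteqP; split=> w /=; first by move=> <- p _; rewrite /= ffunE.
  by move=> gx; apply/ffunP => p; rewrite ffunE; apply: gx.
rewrite (_ : A = \bigcup_(x in [set x | exists2 w, A w & g w = x]) (g @^-1` [set x])).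
  by apply: fin_bigcup_measurable => [|x _]; [apply: finite_finset|apply: mg].
apply/seteqP; split=> [w Aw|w [x [w' Aw' gx]] /= gw]; first by exists (g w) => //; exists w.
apply: (dA w') Aw' => s n st nL.
have /ffunP/(_ (Ordinal st, Ordinal nL)) : g w' = g w by rewrite gx gw.
by rewrite !ffunE.
Qed.

Lemma measurable_fun_determined d' (T' : measurableType d') t (f : T -> T') :
  (forall w w', (forall s n, (s < t)%N -> (n < L)%N -> obs s n w = obs s n w') ->
     f w = f w') -> measurable_fun setT f.
Proof.
move=> df _ B mB; rewrite setTI; apply: (@measurable_determined t) => w w' ww' /=.
by rewrite (df _ _ ww').
Qed.

Lemma inner_test_determined (ys ys' : nat -> Y) :
  (forall n, (n < L)%N -> ys n = ys' n) -> len ys = len ys' /\ out ys = out ys'.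
Proof.
by move=> e; apply: inner_test_stopped => // n /leq_trans/(_ (inner_length_le _ _ _ _)) /e.
Qed.

Lemma hist_determined t w w' :
  (forall s n, (s < t)%N -> (n < L)%N -> obs s n w = obs s n w') -> hist t w = hist t w'.
Proof.
move=> e; apply: eq_run_history => s st.
by have [] // := @inner_test_determined (path w s) (path w' s) (fun n => e s n st).
Qed.

(** ** The law of one inner test given the past *)

(** The observations actually taken, padded by y0; record lists them for the steps
    before t. *)
Let taken (ys : nat -> Y) n := if (n < len ys)%N then ys n else y0.

Let record t w : {ffun 'I_t -> {ffun 'I_L -> Y}} :=
  [ffun s : 'I_t => [ffun n : 'I_L => taken (path w s) n]].

Lemma len_taken ys : len (taken ys) = len ys.
Proof.
by have [] // := @inner_test_stopped _ _ (absence S) (test_rho1 S) _ level_ge0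
  ys (taken ys) => n nl; rewrite /taken nl.
Qed.

Lemma recordP t w w' : record t w = record t w' <->
  (forall s n, (s < t)%N -> (n < len (path w s))%N -> obs s n w = obs s n w').
Proof.
split=> e; last first.
  apply/ffunP => s; rewrite !ffunE; apply/ffunP => n; rewrite !ffunE.
  have [lenE _] := inner_test_stopped level_ge0 (fun n => @e s n (ltn_ord s)).
  rewrite /taken -lenE; case: ifP => // nl; exact: e.
have takenE s n : (s < t)%N -> (n < L)%N -> taken (path w s) n = taken (path w' s) n.
  move=> st nL; move/ffunP/(_ (Ordinal st)): e; rewrite !ffunE => /ffunP/(_ (Ordinal nL)).
  by rewrite !ffunE.
move=> s n st nl; have nL := leq_trans nl (inner_length_le _ _ _ _).
have lenE : len (path w s) = len (path w' s).
  rewrite -(len_taken (path w s)) -(len_taken (path w' s)).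
  by have [] // := inner_test_determined (fun k => @takenE s k st).
by have := takenE s n st nL; rewrite /taken -lenE nl.
Qed.

Lemma record_hist t w w' : record t w = record t w' -> hist t w = hist t w'.
Proof.
move=> /recordP e; apply: eq_run_history => s st.
by have [] // := inner_test_stopped level_ge0 (fun n => @e s n st).
Qed.

Lemma measurable_record t x : measurable (record t @^-1` [set x]).
Proof.
apply: (@measurable_determined t) => w w' e /= <-; apply/esym/recordP => s n st nl.
by apply: e => //; exact: leq_trans nl (inner_length_le _ _ _ _).
Qed.

Definition prefix_event t (h : history M) (ys : seq Y) : set T :=
  [set w | hist t w = h /\ forall n, (n < size ys)%N -> obs t n w = nth y0 ys n].

Lemma measurable_prefix_event t h ys : (size ys <= L)%N ->
  measurable (prefix_event t h ys).
Proof.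
move=> sL; apply: (@measurable_determined t.+1) => w w' e [hw yw]; split.
  by rewrite -(@hist_determined t w) // => s n st; apply: e; apply: ltnW.
by move=> n ns; rewrite -yw // e // (leq_trans ns).
Qed.

(** The model speaks of the past through the observations taken, the history only
    through the outputs: the event is cut into the cells on which all the observations
    taken before step t are fixed. *)
Lemma prefix_event_next t h ys y :
  (size ys < len (nth y0 ys))%N ->
  P (prefix_event t h (rcons ys y)) = ((law (search h) y)%:E * P (prefix_event t h ys))%E.
Proof.
move=> alive; have [mobs modelE] := model.
have sL : (size ys < L)%N := leq_trans alive (inner_length_le _ _ _ _).
have -> : prefix_event t h (rcons ys y) =
    prefix_event t h ys `&` [set w | obs t (size ys) w = y].
  apply/seteqP; split=> w /=.
    move=> [hw yw]; split; last by rewrite yw ?size_rcons // nth_rcons ltnn eqxx.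
    by split=> // n ns; rewrite yw ?size_rcons ?(ltnW ns) // ?ltnS ?(ltnW ns) // nth_rcons ns.
  move=> [[hw yw] ywt]; split=> // n; rewrite size_rcons ltnS leq_eqVlt nth_rcons.
  by case: ltngtP => // [ns _|->]; [apply: yw|rewrite ywt].
have mE := measurable_prefix_event t h (ltnW sL).
have mEy : measurable (prefix_event t h ys `&` [set w | obs t (size ys) w = y]).
  by apply: measurableI => //; apply: mobs.
rewrite (measure_partition P mEy (@measurable_record t)).
rewrite [in RHS](measure_partition P mE (@measurable_record t)) ge0_sume_distrr //.
apply: eq_bigr => x _; rewrite setIAC.
have [[w0 [E0 x0]]|empty] := pselect (exists w, (prefix_event t h ys `&` record t @^-1` [set x]) w);
  last first.
  rewrite (_ : _ `&` record t @^-1` _ = set0); first by rewrite set0I !measure0 mule0.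
  by apply/seteqP; split=> w //= Ew; apply: empty; exists w.
(* on this cell the past is the past of w0, followed by ys *)
pose hh s n := if (s < t)%N then obs s n w0 else nth y0 ys n.
suff -> : prefix_event t h ys `&` record t @^-1` [set x] =
    past_event M_gt0 S obs hh t (size ys) (search h) by apply: modelE.
have {}x0 : record t w0 = x by [].
apply/seteqP; split=> w /=.
  move=> [[hw yw] xw]; rewrite -x0 in xw; move/recordP: (xw) => e; split.
  - by move=> s n st; rewrite /run_length /hh st; apply: e.
  - by move=> n ns; rewrite /hh ltnn yw.
  - move/lt_inner_length: alive => [_ nc].
    apply/lt_inner_length; split=> // m m0 ms.
    rewrite (@eq_crossing _ _ _ _ _ (nth y0 ys)) ?nc // => n nm.
    by apply: yw; apply: leq_trans ms.
  - by rewrite /run_loc hw.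
move=> [past pres _ _].
have xw : record t w = record t w0.
  by apply/recordP => s n st nl; have := past s n st nl; rewrite /hh st.
split; last by rewrite xw.
have [h0 _] := E0; split=> [|n ns]; first by rewrite (record_hist xw).
by have := pres n ns; rewrite /hh ltnn.
Qed.

(** F only looks at the observations that the inner test takes. *)
Definition stopped (F : (nat -> Y) -> R) : Prop := forall ys ys',
  (forall n, (n < len ys)%N -> ys n = ys' n) -> F ys = F ys'.

Lemma measurable_stopped t (F : (nat -> Y) -> R) : stopped F ->
  measurable_fun setT (fun w => (F (path w t))%:E).
Proof.
move=> sF; apply: (@measurable_fun_determined _ _ t.+1) => w w' e; congr EFin.
by apply: sF => n nl; apply: e => //; exact: leq_trans nl (inner_length_le _ _ _ _).
Qed.

(** Backward induction on the number of observations already seen. *)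
Lemma integral_prefix_event t h k ys (F : (nat -> Y) -> R) :
  stopped F -> (forall o, 0 <= F o) ->
  (size ys + k = L.+1)%N -> (size ys <= L)%N ->
  (\int[P]_(w in prefix_event t h ys) (F (path w t))%:E =
   P (prefix_event t h ys) *
   (iid_mean (law (search h)) k (fun s => F (nth y0 (ys ++ s))))%:E)%E.
Proof.
move=> sF F0; elim: k ys => [|k IHk] ys yk yL; first by lia.
have mE := measurable_prefix_event t h yL.
have [_ law1] := law_pmf (search h).
have [stop|go] := leqP (len (nth y0 ys)) (size ys).
  (* the test has stopped: F is constant on the event *)
  have FE (o : nat -> Y) : (forall n, (n < size ys)%N -> nth y0 ys n = o n) ->
      F o = F (nth y0 ys).
    by move=> e; apply/esym/sF => n nl; apply: e; apply: leq_trans stop.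
  rewrite (@eq_iid_mean _ _ _ _ _ (fun=> F (nth y0 ys))) => [|s _]; last first.
    by apply: FE => n ns; rewrite nth_cat ns.
  rewrite iid_mean_cst // (eq_integral (cst (F (nth y0 ys))%:E)) => [|w].
    by rewrite integral_cst // muleC.
  by rewrite inE => -[_ yw] /=; rewrite FE // => n ns; rewrite /path yw.
have sL : (size ys < L)%N := leq_trans go (inner_length_le _ _ _ _).
have mobs y : measurable ((fun w => obs t (size ys) w) @^-1` [set y]).
  by have [mo _] := model; apply: mo.
rewrite (integral_partition P mE mobs (measurable_stopped t sF)) => [|w]; last by rewrite lee_fin.
rewrite /= -sumEFin ge0_sume_distrr; last first.
  move=> y _; rewrite lee_fin mulr_ge0 //.
  rewrite -[leLHS](@iid_mean_cst _ _ (law (search h)) k 0) //.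
  by apply: ler_iid_mean.
apply: eq_bigr => y _.
have -> : prefix_event t h ys `&` (fun w => obs t (size ys) w) @^-1` [set y] =
    prefix_event t h (rcons ys y).
  apply/seteqP; split=> w /=.
    move=> [[hw yw] ywt]; split=> // n; rewrite size_rcons ltnS leq_eqVlt nth_rcons.
    by case: ltngtP => // [ns _|->]; [apply: yw|rewrite ywt].
  move=> [hw yw]; split; last by rewrite yw ?size_rcons // nth_rcons ltnn eqxx.
  by split=> // n ns; rewrite yw ?size_rcons ?ltnS ?(ltnW ns) // nth_rcons ns.
rewrite IHk ?size_rcons ?addSnnS // prefix_event_next // EFinM muleA [(P _ * _)%E]muleC.
by congr (_ * _%:E)%E; apply: eq_iid_mean => s _; rewrite cat_rcons.
Qed.

(** Conditioning on the history: the inner test of the next step behaves as on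
    i.i.d. observations from the law at the location searched. *)
Lemma integral_step t (F : history M -> (nat -> Y) -> R) :
  (forall h, stopped (F h)) -> (forall h o, 0 <= F h o) ->
  (\int[P]_w (F (hist t w) (path w t))%:E =
   \int[P]_w (avg (search (hist t w)) (F (hist t w)))%:E)%E.
Proof.
move=> sF F0.
pose g w : t.-tuple ('I_M * bool) :=
  Tuple (introT eqP (size_run_history (path w) t)).
have gE h : g @^-1` [set h] = prefix_event t h [::].
  apply/seteqP; split=> w /=; first by move=> <-.
  by move=> [e _]; apply/val_inj.
have mg h : measurable (g @^-1` [set h]) by rewrite gE; apply: measurable_prefix_event.
rewrite (integral_partition P measurableT mg) //; last first.
- by move=> w; rewrite lee_fin.
- apply: (@measurable_fun_determined _ _ t.+1) => w w' e.
  rewrite (@hist_determined t w w') => [|s n st]; last by apply: e; apply: ltnW.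
  congr EFin; apply: sF => n nl; apply: e => //.
  exact: leq_trans nl (inner_length_le _ _ _ _).
rewrite [RHS](integral_partition P measurableT mg) //; last first.
- move=> w; rewrite lee_fin -[leLHS](@inner_avg_cst _ _ y0 (test_rho1 S) (level S) _ (law_pmf (search (hist t w))).2).
  by apply: inner_avg_le.
- by apply: (@measurable_fun_determined _ _ t) => w w' e; rewrite (hist_determined e).
apply: eq_bigr => h _; rewrite setTI gE.
transitivity (\int[P]_(w in prefix_event t h [::]) (F h (path w t))%:E)%E.
  by apply: eq_integral => w; rewrite inE => -[->].
rewrite (@integral_prefix_event t h L.+1) //.
rewrite [RHS](eq_integral (cst (avg (search h) (F h))%:E)) => [|w]; last first.
  by rewrite inE => -[->].
rewrite integral_cst; last by rewrite -gE.
exact: muleC.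
Qed.

Definition search_alarm_prob u : R := inner_alarm_prob y0 (absence S) (test_rho1 S) (level S) (law u).

Lemma search_alarm_prob_ge0 u : 0 <= search_alarm_prob u.
Proof. by apply: inner_alarm_prob_ge0 => //; have [] := law_pmf u. Qed.

Lemma search_alarm_prob_le1 u : search_alarm_prob u <= 1.
Proof. by apply: inner_alarm_prob_le1 => //; have [] := law_pmf u. Qed.

Lemma integral_hist t (f : history M -> R) : (forall h, 0 <= f h) ->
  (\int[P]_w (f (hist t w))%:E = (hist_mean M_gt0 S search_alarm_prob t f)%:E)%E.
Proof.
elim: t f => [|t IHt] f f0 /=.
  transitivity ((f [::])%:E * P setT)%E; last by rewrite probability_setT mule1.
  exact: integral_cst.
rewrite -IHt => [|h]; last first.
  by rewrite addr_ge0 // mulr_ge0 // ?subr_ge0 ?search_alarm_prob_ge0 ?search_alarm_prob_le1.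
rewrite (@integral_step t (fun h o => f (rcons h (search h, out o)))) //.
  apply: eq_integral => w _; congr EFin.
  by rewrite (inner_avg_out _ _ _ _ (law_pmf _).2 (fun z => f (rcons _ (_, z)))).
by move=> h ys ys' /(inner_test_stopped level_ge0)[_ ->].
Qed.

Lemma prob_hist t (p : pred (history M)) :
  P [set w | p (hist t w)] = (hist_mean M_gt0 S search_alarm_prob t (fun h => (p h)%:R))%:E.
Proof.
rewrite -integral_hist // -[X in P X]setIT -integral_indic //.
  apply: eq_integral => w _; rewrite indicE; congr ((nat_of_bool _)%:R%:E).
  by apply/idP/idP; rewrite inE.
by apply: (@measurable_determined t) => w w' e /=; rewrite (hist_determined e).
Qed.

(** ** Wald's identity and the error event *)

Lemma before_run_tau w t :
  before (run_tau M_gt0 S (path w)) t = alive S (hist t w).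
Proof.
rewrite /run_tau; set q := (X in first_time X).
have qE s : (s <= t)%N -> q s = (0 < s)%N && stop S (take s (hist t w)).
  by move=> st; rewrite take_run_history.
have aliveP : reflect (forall s, (s <= t)%N -> ~~ q s) (alive S (hist t w)).
  rewrite /alive size_run_history; apply: (iffP allP) => [al s st|al s].
    rewrite qE // negb_and; case: (posnP s) => //= s0.
    by apply: al; rewrite mem_iota s0 add1n ltnS.
  rewrite mem_iota add1n ltnS => /andP[s0 st].
  by have := al s st; rewrite qE // s0.
have := first_timeP q; case: first_time => [n [qn n_min]|nq] /=; apply/idP/aliveP.
- by move=> tn s st; apply/negP => /n_min; rewrite leqNgt (leq_ltn_trans st).
- by move=> al; rewrite ltnNge; apply/negP => /al; rewrite qn.
- by move=> _ s _.
- by [].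
Qed.

Let stepcost t := hist_mean M_gt0 S search_alarm_prob t
  (fun h => (alive S h)%:R * cost S mu i (search h)).

Lemma cost_ge0 u : 0 <= cost S mu i u.
Proof. by apply: inner_mean_ge0 => //; have [] := law_pmf u. Qed.

Lemma expected_run_sum (f : T -> nat -> R) : (forall w t, 0 <= f w t) ->
  (forall t, measurable_fun setT (fun w => ((alive S (hist t w))%:R * f w t)%:E)) ->
  (\int[P]_w run_sum M_gt0 S (path w) (f w) =
   \sum_(0 <= t <oo) \int[P]_w ((alive S (hist t w))%:R * f w t)%:E)%E.
Proof.
move=> f0 mf; rewrite -integral_nneseries //; last first.
  by move=> t w _; rewrite lee_fin mulr_ge0.
apply: eq_integral => w _; rewrite /run_sum eseries_mkcond.
apply: eq_eseriesr => t _; rewrite before_run_tau.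
by case: alive; rewrite ?mul1r ?mul0r.
Qed.

Lemma expected_costE :
  expected_cost M_gt0 S mu i P obs = (\sum_(0 <= t <oo) (stepcost t)%:E)%E.
Proof.
rewrite /expected_cost (expected_run_sum (f := fun w t => cost S mu i (search (hist t w)))).
- apply: eq_eseriesr => t _.
  rewrite (@integral_hist t (fun h => (alive S h)%:R * cost S mu i (search h))) // => h.
  by rewrite mulr_ge0 // cost_ge0.
- by move=> w t; apply: cost_ge0.
- move=> t; apply: (@measurable_fun_determined _ _ t) => w w' e.
  by rewrite (hist_determined e).
Qed.

Lemma expected_samplesE :
  expected_samples M_gt0 S P obs = expected_cost M_gt0 S mu i P obs.
Proof.
have sl h : stopped (fun o => (alive S h)%:R * (len o)%:R).
  by move=> ys ys' /(inner_test_stopped level_ge0)[-> _].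
rewrite expected_costE /expected_samples.
rewrite (expected_run_sum (f := fun w t => (len (path w t))%:R)) //; last first.
  move=> t; apply: (@measurable_fun_determined _ _ t.+1) => w w' e.
  rewrite (@hist_determined t w w') => [|s n st]; last by apply: e; apply: ltnW.
  by have [-> _] := @inner_test_determined (path w t) (path w' t) (fun n => e t n (ltnSn t)).
apply: eq_eseriesr => t _.
rewrite (@integral_step t (fun h o => (alive S h)%:R * (len o)%:R)) //.
rewrite /stepcost -integral_hist => [|h]; last by rewrite mulr_ge0 // cost_ge0.
apply: eq_integral => w _; congr EFin.
by rewrite /inner_avg iid_meanZ /cost (inner_meanE y0).
Qed.

Lemma expected_cost_le (C : R) : (forall n, \sum_(t < n) stepcost t <= C) ->
  (expected_cost M_gt0 S mu i P obs <= C%:E)%E.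
Proof.
move=> le; rewrite expected_costE; apply: lime_le.
  apply: is_cvg_nneseries => t _ _; rewrite lee_fin.
  apply: hist_mean_ge0 => [u|u|h]; [exact: search_alarm_prob_ge0|exact: search_alarm_prob_le1|].
  by rewrite mulr_ge0 // cost_ge0.
by near=> n; rewrite sumEFin lee_fin big_mkord.
Unshelve. all: by end_near.
Qed.

Lemma measurable_error : measurable (error_event M_gt0 S i obs).
Proof.
have -> : error_event M_gt0 S i obs = ~` \bigcup_(t in [set: nat])
    [set w | [&& (0 < t)%N, stop S (hist t w), estimate S (hist t w) == i &
      all (fun s => ~~ stop S (hist s w)) (iota 1 t.-1)]].
  rewrite /error_event -[[set w | _ <> _]]/(~` [set w | _ = _]); congr (~` _).
  apply/seteqP; split=> w /=; rewrite /run_decision /run_tau; set q := (X in first_time X);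
    have := first_timeP q; case: first_time => [n [qn n_min]|nq] //.
  - move=> [ei]; exists n => //=; move/andP: (qn) => [n0 ->]; rewrite n0 ei eqxx /=.
    apply/allP => s; rewrite mem_iota => /andP[s0]; rewrite add1n prednK // => sn.
    by apply/negP => st; have := n_min s; rewrite /q s0 st => /(_ isT); rewrite leqNgt sn.
  - move=> [t _ /= /and4P[t0 st /eqP ei al]].
    suff -> : n = t by rewrite -ei.
    have nt : (n <= t)%N by apply: n_min; rewrite /q t0.
    apply/eqP; rewrite eqn_leq nt leqNgt; apply/negP => lt.
    move/andP: qn => [n0 sn]; move/allP/(_ n): al.
    by rewrite mem_iota n0 add1n prednK // lt sn => /(_ isT).
  - by move=> [t _ /= /and4P[t0 st _ _]]; have := nq t; rewrite /q t0 st.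
apply: measurableC; apply: bigcup_measurable => t _.
apply: (@measurable_determined t) => w w' e /=.
rewrite (hist_determined e) => /and4P[-> -> -> /allP al] /=.
apply/allP => s st; have {}al := al s st.
rewrite -(@hist_determined s w) // => s' n s's; apply: e.
by move: st; rewrite mem_iota => /andP[_]; lia.
Qed.

Lemma error_event_le (t : nat) (p : R) : (0 < t)%N ->
  hist_mean M_gt0 S search_alarm_prob t (fun h => (bad_stop S i h || ~~ stop S h)%:R) <= p ->
  (P (error_event M_gt0 S i obs) <= p%:E)%E.
Proof.
move=> t0 le; apply: (@le_trans _ _ (P [set w | bad_stop S i (hist t w) || ~~ stop S (hist t w)])).
  apply: le_measure; rewrite ?inE.
  - exact: measurable_error.
  - by apply: (@measurable_determined t) => w w' e /=; rewrite (hist_determined e).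
  move=> w /=; rewrite /error_event /= /run_decision /run_tau; set q := (X in first_time X).
  have := first_timeP q; case: first_time => [n [qn n_min]|nq] err; last first.
    by apply/orP; right; have := nq t; rewrite /q t0.
  have [nt|tn] := leqP n t; apply/orP; [left|right].
    move/andP: qn => [n0 sn]; apply/hasP; exists n.
      by rewrite mem_iota n0 size_run_history add1n ltnS.
    by rewrite take_run_history // sn /=; apply/eqP => ei; apply: err; rewrite ei.
  by apply/negP => st; have := n_min t; rewrite /q t0 st => /(_ isT); rewrite leqNgt tn.
by rewrite (prob_hist t (fun h => bad_stop S i h || ~~ stop S h)) lee_fin.
Qed.

End Link.

(** * Growth of the parameters with a *)

Section Growth.
Variables (R : realType).

Lemma near_gt (A : R) : \forall a \near +oo_R, A < a.
Proof. by apply: nbhs_pinfty_gt; rewrite num_real. Qed.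

Lemma near_ln (A : R) : \forall a \near +oo_R, A <= ln a.
Proof.
near=> a; have aA : expR A < a by near: a; apply: near_gt.
by rewrite -[A]expRK ler_ln ?posrE ?expR_gt0 // ?ltW // (lt_trans (expR_gt0 A)).
Unshelve. all: by end_near. Qed.

Lemma near_powR_ln (c p : R) : 0 < p -> \forall a \near +oo_R, c * ln a <= a `^ p.
Proof.
move=> p0; near=> a.
have a0 : 0 < a by near: a; apply: near_gt.
have l0 : 0 <= ln a by near: a; apply: near_ln.
have lc : 2 * c / p ^+ 2 <= ln a by near: a; apply: near_ln.
rewrite /powR gt_eqF //.
have := @expR_ge1Dxn R (p * ln a) 1 (mulr_ge0 (ltW p0) l0).
move/(le_trans _); apply; rewrite (_ : 2`!%:R = 2) //.
move: lc; rewrite ler_pdivrMr ?exprn_gt0 // exprMn => lc.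
have : 0 <= ln a * (ln a * p ^+ 2 - 2 * c) by rewrite mulr_ge0 // subr_ge0.
by rewrite mulrBr; move: l0; nra.
Unshelve. all: by end_near. Qed.

Lemma ln_shift (a : R) : 2 < a -> ln a - ln 2 <= ln (a - 1).
Proof.
move=> a2; have a0 : 0 < a by lra.
by rewrite -ln_div ?posrE // ler_ln ?posrE ?divr_gt0 //; lra.
Qed.

Lemma near_sublinear (k c : R) : 0 < k -> 0 <= c ->
  \forall x \near +oo_R, x `^ (2 / 3) + c * ln (x + 1) <= x * k.
Proof.
move=> k0 c0; near=> x.
have x2 : 2 < x by near: x; apply: near_gt.
have x0 : 0 < x by lra.
have l2k : 2 / k <= ln x by near: x; apply: near_ln.
have p13 : 1 * ln x <= x `^ (1 / 3) by near: x; apply: near_powR_ln.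
have lc : 4 * c / k * ln x <= x `^ 1 by near: x; apply: near_powR_ln.
have e1 : x `^ (2 / 3) <= x * (k / 2).
  have yz : x `^ (2 / 3) * x `^ (1 / 3) = x.
    rewrite -powRD; last by rewrite gt_eqF ?implybT.
    by rewrite (_ : 2 / 3 + 1 / 3 = 1) ?powRr1 ?ltW //; field.
  rewrite -{2}yz -mulrA ler_peMr ?powR_ge0 //.
  rewrite -ler_pdivrMr ?divr_gt0 // [1 / (k / 2)]div1r invf_div; apply: le_trans l2k _.
  by rewrite -[ln x]mul1r.
have e2 : ln (x + 1) <= 2 * ln x.
  rewrite mulr_natl -lnXn // ler_ln ?posrE ?exprn_gt0 ?addr_gt0 //.
  by rewrite expr2; nra.
have e3 : c * ln (x + 1) <= x * (k / 2).
  apply: le_trans (ler_wpM2l c0 e2) _.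
  move: lc; rewrite powRr1 ?(ltW x0) // mulrAC ler_pdivrMr //.
  by lra.
by lra.
Unshelve. all: by end_near. Qed.

Section LevelDependence.
Variables rho1 rho2 delta : R.
Hypotheses (rho1_gt1 : 1 < rho1) (rho2_gt1 : 1 < rho2).
Hypotheses (delta_gt0 : 0 < delta) (delta_le : delta <= 1 / 2).

(** The log-likelihood threshold of the outer test. *)
Definition outer_threshold (a : R) : R := a `^ rho2 * ln a `^ rho1.

(** The upper bound used for both error probabilities of the inner test. It has the
    form 1 / (1 + expR lam), for which the exponential with parameter lam of a walk
    with up-probability inner_error is a martingale; as a function of a it exceeds
    the true order 1 / a by the factor a ^ delta. *)
Definition inner_error (a : R) : R := (1 + expR ((1 - delta) * ln (a - 1)))^-1.

Local Notation lam a := ((1 - delta) * ln (a - 1)).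

Lemma inner_error_gt0 a : 0 < inner_error a.
Proof. by rewrite invr_gt0 addr_gt0 ?expR_gt0. Qed.

Lemma inner_error_martingale a :
  inner_error a * expR (lam a) + (1 - inner_error a) * expR (- lam a) = 1.
Proof.
rewrite /inner_error expRN.
by field; rewrite !gt_eqF ?addr_gt0 ?expR_gt0.
Qed.

Lemma near_inner_error_small (c : R) : 0 <= c ->
  \forall a \near +oo_R, c * inner_error a <= 1.
Proof.
have d1 := delta_le.
move=> c0; near=> a.
have a2 : 2 < a by near: a; apply: near_gt.
have la : 2 * c + ln 2 <= ln a by near: a; apply: near_ln.
rewrite ler_pdivrMr ?addr_gt0 ?expR_gt0 // mul1r.
apply: (@le_trans _ _ (1 + lam a)); last first.
  by apply: le_trans (expR_ge1Dx _) _; rewrite lerDr.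
have l2 := ln_shift a2.
have : 0 <= (1 / 2 - delta) * ln (a - 1) by rewrite mulr_ge0 ?subr_ge0 //; lra.
by lra.
Unshelve. all: by end_near. Qed.

Lemma near_inner_error_large : \forall a \near +oo_R,
  12 / a <= inner_error a /\ 1 <= inner_error a * a.
Proof.
have [d0 d1] := (delta_gt0, delta_le).
near=> a.
have a2 : 2 < a by near: a; apply: near_gt.
have a0 : 0 < a by lra.
have l24 : 24 <= ln a by near: a; apply: near_ln.
have ad : 1 * ln a <= a `^ delta by near: a; apply: near_powR_ln.
have main : 12 * (1 + expR (lam a)) <= a.
  have e1 : expR (lam a) <= a `^ (1 - delta).
    rewrite /powR gt_eqF // ler_expR; apply: ler_wpM2l; first by lra.
    by rewrite ler_ln ?posrE; lra.
  have aa : a `^ (1 - delta) * a `^ delta = a.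
    rewrite -powRD; last by rewrite (gt_eqF a0) implybT.
    by rewrite subrK powRr1 // ltW.
  have e2 : 1 <= a `^ (1 - delta).
    by rewrite -[leLHS](powRr0 a) ler_powR //; lra.
  have : 0 <= a `^ (1 - delta) * (a `^ delta - 24).
    by rewrite mulr_ge0 ?powR_ge0 //; lra.
  by rewrite mulrBr aa; lra.
have th0 : 0 < 1 + expR (lam a) by rewrite addr_gt0 ?expR_gt0.
rewrite /inner_error; split.
  by rewrite ler_pdivrMr // mulrC ler_pdivlMr.
by rewrite [leRHS]mulrC ler_pdivlMr // mul1r; move: th0; lra.
Unshelve. all: by end_near. Qed.

Local Notation L a := (Num.truncn (inner_horizon rho1 a)).

Lemma horizon_ge (a : R) : 0 < a -> 1 <= ln a -> a <= inner_horizon rho1 a.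
Proof.
have r1 := rho1_gt1.
move=> a0 l1; rewrite -[leLHS]mulr1 ler_pM2l //.
by rewrite -[leLHS](powRr0 (ln a)) ler_powR //; lra.
Qed.

Lemma near_geometric_horizon (r : R) : 0 <= r -> r < 1 ->
  \forall a \near +oo_R, r ^+ L a <= inner_error a.
Proof.
move=> r0 r1; near=> a.
have a2 : 2 < a by near: a; apply: near_gt.
have a0 : 0 < a by lra.
have l1 : 1 <= ln a by near: a; apply: near_ln.
have r1' : 0 < 1 - r by lra.
have la : 2 / (1 - r) * ln a <= a `^ 1 by near: a; apply: near_powR_ln.
have [_ ea] : 12 / a <= inner_error a /\ 1 <= inner_error a * a.
  by near: a; apply: near_inner_error_large.
apply: (@le_trans _ _ a^-1); last by rewrite -div1r ler_pdivrMr.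
have La : a - 1 <= (L a)%:R.
  have := truncnS_gt (inner_horizon rho1 a); rewrite -natr1.
  by have := horizon_ge a0 l1; lra.
apply: (@le_trans _ _ (expR (- (1 - r)) ^+ L a)).
  by apply: lerXn2r; rewrite ?nnegrE ?expR_ge0 //; have := expR_ge1Dx (- (1 - r)); lra.
rewrite -expRM_natl -[a in leRHS](lnK a0) -expRN ler_expR mulrN lerN2.
move: la; rewrite powRr1 ?(ltW a0) // mulrAC ler_pdivrMr // => la.
have : 0 <= ((L a)%:R - (a - 1)) * (1 - r) by rewrite mulr_ge0 ?subr_ge0 // ltW.
by nra.
Unshelve. all: by end_near. Qed.

Lemma outer_threshold_ge (a : R) : 1 < a -> 1 <= ln a -> ln a <= outer_threshold a.
Proof.
have [r1 r2] := (rho1_gt1, rho2_gt1).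
move=> a1 l1; have p2 : 1 <= a `^ rho2 by rewrite -[leLHS](powRr0 a) ler_powR //; lra.
have p1 : ln a <= ln a `^ rho1.
  by rewrite -[leLHS]powRr1 ?ler_powR //; lra.
by apply: le_trans p1 _; rewrite ler_peMl // powR_ge0.
Qed.

Lemma near_outer_threshold (A : R) : \forall a \near +oo_R, A <= outer_threshold a.
Proof.
near=> a; apply: (@le_trans _ _ (ln a)); first by near: a; apply: near_ln.
apply: outer_threshold_ge; first by near: a; apply: near_gt.
by near: a; apply: near_ln.
Unshelve. all: by end_near. Qed.

Lemma near_margin_le (s : R) : 0 < s -> \forall a \near +oo_R,
  1 + outer_threshold a / ln (a - 1) <= (1 + s) * (outer_threshold a / ln a).
Proof.
have [r1 r2] := (rho1_gt1, rho2_gt1).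
move=> s0; near=> a.
have a2 : 2 < a by near: a; apply: near_gt.
have a0 : 0 < a by lra.
have l1 : 1 + 4 * ln 2 / s + 2 * ln 2 <= ln a by near: a; apply: near_ln.
have [l0 ll] : 1 <= ln a /\ 2 / s * ln a <= a `^ rho2.
  by split; near: a; [apply: near_ln|apply: near_powR_ln; lra].
have l2 : 0 < ln 2 :> R by rewrite ln_gt0 // ltr1n.
have sh := ln_shift a2.
have l41 : 4 * ln 2 / s <= ln a by lra.
have l4 : 0 <= 4 * ln 2 / s by rewrite divr_ge0 ?mulr_ge0 ?ltW.
have lm : 0 < ln (a - 1) by lra.
have th : 2 / s * ln a <= outer_threshold a.
  apply: le_trans ll _; rewrite ler_peMr ?powR_ge0 //.
  by rewrite -[leLHS](powRr0 (ln a)) ler_powR //; lra.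
have Ta : 0 <= outer_threshold a by rewrite mulr_ge0 ?powR_ge0.
have lna : 0 < ln a by lra.
move: (outer_threshold a) th Ta => t th Ta.
(* 1 <= (s / 2) t / ln a and ln a <= (1 + s / 2) ln (a - 1) *)
have e1 : 1 <= s / 2 * (t / ln a).
  rewrite mulrA ler_pdivlMr // mul1r.
  have := ler_wpM2l (ltW (divr_gt0 s0 (ltr0n R 2 : 0 < 2))) th.
  by rewrite mulrA (_ : s / 2 * (2 / s) = 1) ?mul1r //; field; rewrite gt_eqF.
have e2 : t / ln (a - 1) <= (1 + s / 2) * (t / ln a).
  have e3 : ln a <= (1 + s / 2) * ln (a - 1).
    move: l41; rewrite ler_pdivrMr // => l41.
    by have := ler_wpM2l (ltW s0) sh; nra.
  rewrite ler_pdivrMr // (_ : _ * _ * _ = t * ((1 + s / 2) * ln (a - 1) / ln a)).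
    by rewrite ler_peMr // ler_pdivlMr // mul1r.
  by field; rewrite gt_eqF.
by lra.
Unshelve. all: by end_near. Qed.

(** The steps spent away from the target, each costing at most the horizon, are
    negligible since rho2 > 1. *)
Lemma near_wait_le (b C s : R) : 0 < b -> 0 <= C -> 0 < s -> \forall a \near +oo_R,
  (L a)%:R * (C + ln (outer_threshold a / ln (a - 1) + 1) / b) <= s * outer_threshold a.
Proof.
have [r1 r2] := (rho1_gt1, rho2_gt1).
move=> b0 C0 s0; near=> a.
have a4 : 4 < a by near: a; apply: near_gt.
have a0 : 0 < a by lra.
have l1 : 2 + ln 2 <= ln a by near: a; apply: near_ln.
have l2 : 0 < ln 2 :> R by rewrite ln_gt0 // ltr1n.
pose c := (C + (1 + rho1 + rho2) / b) / s.
have lc : c * ln a <= a `^ (rho2 - 1) by near: a; apply: near_powR_ln; lra.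
have sh := @ln_shift a (lt_trans (_ : 2 < 4) a4).
have lm : 1 <= ln (a - 1) by have := sh (ltr_nat R 2 4); lra.
have la : 1 <= ln a by lra.
have la0 : 0 < ln a by lra.
set t := outer_threshold a.
have t1 : 1 <= t by apply: le_trans la _; apply: outer_threshold_ge; lra.
have lm0 : 0 < ln (a - 1) by lra.
have t0 : 0 < t by apply: lt_le_trans t1.
have q0 : 0 <= t / ln (a - 1) by rewrite ltW // divr_gt0.
have q1 : t / ln (a - 1) <= t by rewrite ler_pdivrMr // ler_peMr // ltW.
have e1 : ln (t / ln (a - 1) + 1) <= (1 + rho1 + rho2) * ln a.
  apply: (@le_trans _ _ (ln (2 * t))).
    rewrite ler_ln ?posrE; first by move: q0 q1; lra.
      by move: q0; lra.
    by rewrite mulr_gt0.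
  rewrite lnM ?posrE //.
  rewrite (_ : ln t = rho2 * ln a + rho1 * ln (ln a)); last first.
    by rewrite /t /outer_threshold lnM ?posrE ?powR_gt0 // !ln_powR.
  have : rho1 * ln (ln a) <= rho1 * ln a.
    by apply: ler_wpM2l; [lra|apply/ltW/ln_sublinear].
  by lra.
have Lle : (L a)%:R <= a * ln a `^ rho1 by rewrite truncn_le mulr_ge0 ?powR_ge0 // ltW.
have e2 : C + ln (t / ln (a - 1) + 1) / b <= s * a `^ (rho2 - 1).
  apply: le_trans (_ : s * (c * ln a) <= _); last by rewrite ler_pM2l.
  rewrite /c mulrA mulrCA mulfV ?gt_eqF // mulr1 mulrDl; apply: lerD.
    by rewrite ler_peMr.
  by rewrite [leRHS]mulrAC ler_pM2r ?invr_gt0.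
apply: (@le_trans _ _ (a * ln a `^ rho1 * (s * a `^ (rho2 - 1)))).
  apply: ler_pM => //; rewrite addr_ge0 // divr_ge0 ?(ltW b0) // ln_ge0 //.
  by rewrite lerDr.
rewrite le_eqVlt; apply/orP; left; apply/eqP.
rewrite /t /outer_threshold -(@mulr_powRB1 _ a rho2) ?ltW //; last by lra.
by ring.
Unshelve. all: by end_near. Qed.

(** From time (1 + s) ln a / D on, the term ln a of the inner threshold is at most
    n D / (1 + s), and the other terms are sublinear in n. *)
Lemma near_detection_start (D s c : R) (n : nat) : 0 < D -> 0 < s ->
  let xi := (D - D / (1 + s)) / 2 in
  \forall a \near +oo_R, exists N0 : nat, [/\ (0 < N0)%N, (N0 <= L a)%N,
    forall m, (N0 <= m)%N ->
      ln a + m%:R `^ (2 / 3) + n%:R * ln (m%:R + 1) <= m%:R * (D - xi) &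
    N0%:R + c <= (1 + s) ^+ 2 * (ln a / D)].
Proof.
move=> D0 s0 xi; have s1 : 0 < 1 + s by lra.
have xi0 : 0 < xi.
  by rewrite divr_gt0 // subr_gt0 ltr_pdivrMr // mulrDr mulr1 ltrDl mulr_gt0.
have [X [_ HX]] := @near_sublinear xi n%:R xi0 (ler0n _ _).
near=> a.
have a2 : 2 < a by near: a; apply: near_gt.
have a0 : 0 < a by lra.
have l1 : 1 <= ln a by near: a; apply: near_ln.
pose x := (1 + s) * (ln a / D).
have x0 : 0 <= x by rewrite mulr_ge0 ?divr_ge0 ?ltW //; lra.
have lX : X * D / (1 + s) <= ln a by near: a; apply: near_ln.
have la : ((1 + s) / D + 1) * ln a <= a `^ 1 by near: a; apply: near_powR_ln.
have lc : (1 + c) * D / (s * (1 + s)) <= ln a by near: a; apply: near_ln.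
have xN : x < (Num.truncn x).+1%:R := truncnS_gt x.
have Nx : (Num.truncn x).+1%:R <= x + 1 by rewrite -natr1 lerD2r truncn_le.
exists (Num.truncn x).+1; split=> //.
- rewrite truncn_ge_nat; last by rewrite inner_horizon_ge0 // ltW.
  apply: le_trans _ (horizon_ge a0 l1); apply: le_trans Nx _.
  move: la; rewrite powRr1 ?(ltW a0) //; apply: le_trans.
  by rewrite mulrDl mul1r lerD // /x mulrA mulrAC.
- move=> m Nm; have xm : x < m%:R by apply: lt_le_trans xN _; rewrite ler_nat.
  have Xm : X < m%:R.
    apply: le_lt_trans xm; move: lX; rewrite ler_pdivrMr // => lX.
    by rewrite /x mulrA ler_pdivlMr // [leRHS]mulrC.
  have := HX _ Xm; rewrite -addrA => /(lerD (lexx (ln a)))/le_trans; apply.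
  have : ln a <= m%:R * (D / (1 + s)).
    rewrite mulrA ler_pdivlMr //; move: (ltW xm); rewrite /x mulrA ler_pdivrMr //.
    by rewrite mulrC.
  by rewrite /xi; lra.
apply: le_trans (lerD Nx (lexx c)) _; rewrite -/x.
have : 1 + c <= s * (1 + s) * (ln a / D).
  move: lc; rewrite ler_pdivrMr ?mulr_gt0 // => lc.
  by rewrite [leRHS]mulrA ler_pdivlMr // [leRHS]mulrC.
by rewrite /x; lra.
Unshelve. all: by end_near. Qed.

End LevelDependence.

End Growth.

(** * The universal test at a fixed level *)

Section FixedLevel.
Variables (R : realType) (Y : finType) (M : nat) (M_gt0 : (0 < M)%N).
Variables (pi mu : {ffun Y -> R}) (y0 : Y) (rho1 rho2 delta b a : R).
Hypotheses (pi_pmf : full_pmf pi) (mu_pmf : full_pmf mu).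
Hypotheses (delta_lt1 : delta < 1) (b_gt0 : 0 < b) (a_gt2 : 2 < a).
Variables (sched : nat -> option nat) (rule : history M -> 'I_M).
Hypotheses (schedP : exploration_schedule b sched) (ruleP : argmax_rule rule).
Let S := Test pi rho1 rho2 sched rule a.
Variables (B k1 : nat).
Hypotheses (B_gt1 : (1 < B)%N)
  (visitsP : forall h u J, reachable M_gt0 S h -> (B ^ (J + k1) <= size h)%N ->
     (J <= count (fun x => x.1 == u) h)%N).
Local Notation eps := (inner_error delta a).
Hypotheses (eps_small : 16 * B%:R ^+ 2 * eps <= 1) (eps_large : 12 / a <= eps).
Hypothesis missed_le : 1 - inner_alarm_prob y0 pi rho1 a mu <= eps.

Let a_gt0 : 0 < a. Proof. by apply: lt_trans a_gt2. Qed.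
Let level_ge0 : 0 <= level S. Proof. exact: ltW. Qed.

Section Hypothesis_i.
Variables (i : option 'I_M).
Variables (d : measure_display) (T : measurableType d) (P : probability T R).
Variable obs : nat -> nat -> T -> Y.
Hypothesis model : observation_model M_gt0 S mu i P obs.
Local Notation q := (search_alarm_prob S mu i y0).

Lemma wrong_prob_le u : wrong_prob q i u <= eps.
Proof.
rewrite /wrong_prob /search_alarm_prob /obs_law /=; case: eqP => _ //.
exact: le_trans (false_alarm_le y0 rho1 a_gt0 pi_pmf) eps_large.
Qed.

Let q_ge0 u : 0 <= q u. Proof. exact: search_alarm_prob_ge0. Qed.
Let q_le1 u : q u <= 1. Proof. exact: search_alarm_prob_le1. Qed.

Lemma error_le : (P (error_event M_gt0 S i obs) <=
  (M%:R * expR (- ((1 - delta) * outer_threshold rho1 rho2 a)))%:E)%E.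
Proof.
apply/lee_addgt0Pr => eta eta0; have a2 := a_gt2.
have l0 : 0 < ln (a - 1) by rewrite ln_gt0; lra.
have lam0 : 0 <= (1 - delta) * ln (a - 1).
  by rewrite mulr_ge0 ?subr_ge0 ?(ltW l0) ?(ltW delta_lt1).
have rate : eps * expR ((1 - delta) * ln (a - 1)) +
    (1 - eps) * expR (- ((1 - delta) * ln (a - 1))) <= 1.
  by rewrite inner_error_martingale.
have [t t0 le] := error_prob_le (S := S) q_ge0 q_le1 ruleP wrong_prob_le a_gt2 B_gt1 visitsP
  eps_small lam0 rate eta0.
rewrite -EFinD; apply: (error_event_le (y0 := y0) level_ge0 mu_pmf pi_pmf model t0).
apply: le_trans le _; rewrite lerD2r ler_wpM2l // ler_expR lerN2.
rewrite -mulrA ler_wpM2l ?subr_ge0 ?(ltW delta_lt1) // /margin /outer_threshold /=.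
by rewrite [leRHS]mulrC divfK ?gt_eqF.
Qed.

End Hypothesis_i.

Lemma cost_le (v : 'I_M) (d : measure_display) (T : measurableType d) (P : probability T R)
    (obs : nat -> nat -> T -> Y) :
  observation_model M_gt0 S mu (Some v) P obs ->
  (expected_cost M_gt0 S mu (Some v) P obs <=
   (inner_mean pi rho1 a mu *
      ((1 + outer_threshold rho1 rho2 a / ln (a - 1)) * (1 + cost_cst M b B k1 * eps)) +
    (Num.truncn (inner_horizon rho1 a))%:R *
      (cost_cst M b B k1 + ln (outer_threshold rho1 rho2 a / ln (a - 1) + 1) / b))%:E)%E.
Proof.
move=> model; have [mu0 mu1] := mu_pmf; have [pi0 pi1] := pi_pmf.
have mu_ge0 y : 0 <= mu y := ltW (mu0 y).
have pi_ge0 y : 0 <= pi y := ltW (pi0 y).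
apply: (expected_cost_le (y0 := y0) level_ge0 mu_pmf pi_pmf model) => n.
apply: (run_cost_le (S := S) (eps := eps)) => //.
- by move=> u; apply: search_alarm_prob_ge0.
- by move=> u; apply: search_alarm_prob_le1.
- exact: wrong_prob_le.
- by apply: (inner_mean_ge0 y0 _ _ (ltW a_gt0)).
- move=> u; rewrite /cost /obs_law /= (inj_eq Some_inj) eq_sym.
  by case: eqP => _ //; apply: (inner_mean_leL y0 _ _ (ltW a_gt0)).
Qed.

End FixedLevel.

Lemma slack_product (R : realType) (s t l D : R) : 0 < l -> 0 < D ->
  (1 + s) ^+ 2 * (l / D) * ((1 + s) * (t / l) * (1 + s)) = (1 + s) ^+ 4 * (t / D).
Proof. by move=> l0 D0; field; rewrite !gt_eqF. Qed.

Lemma slack_power (R : realType) (s : R) : 0 <= s -> s <= 1 ->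
  (1 + s) ^+ 4 <= 1 + 15 * s.
Proof.
move=> s0 s1; have s_sq : s ^+ 2 <= s by rewrite expr2 ler_piMr.
have sq1 : (1 + s) ^+ 2 <= 1 + 3 * s by rewrite sqrrD expr1n; lra.
apply: (@le_trans _ _ ((1 + 3 * s) ^+ 2)).
  rewrite -[4%N]/(2 * 2)%N exprM; apply: lerXn2r => //; rewrite nnegrE.
    exact: sqr_ge0.
  by lra.
by rewrite sqrrD expr1n exprMn; lra.
Qed.

Lemma pmf_inhabited (R : realType) (Y : finType) (p : {ffun Y -> R}) : full_pmf p -> Y.
Proof.
move=> [_ p1]; case: (pickP (@predT Y)) => [y _|no]; first exact: y.
by exfalso; move/eqP: p1; rewrite big_pred0 // eq_sym oner_eq0.
Qed.

Theorem theorem4p1 (R : realType) (Y : finType) (M : nat) (M_gt0 : (0 < M)%N)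
    (pi : {ffun Y -> R}) (rho1 rho2 nu : R) :
  full_pmf pi -> 1 < rho1 -> 1 < rho2 -> 0 < nu < 1 ->
  exists b0 : R, 0 < b0 /\
  forall b : R, 0 < b < b0 ->
  forall (sched : nat -> option nat) (rule : history M -> 'I_M),
  exploration_schedule b sched -> argmax_rule rule ->
  forall mu : {ffun Y -> R}, full_pmf mu -> mu != pi ->
  forall (d : measure_display) (T : R -> measurableType d)
    (P : forall a : R, option 'I_M -> probability (T a) R)
    (obs : forall a : R, nat -> nat -> T a -> Y),
  let S := fun a : R => Test pi rho1 rho2 sched rule a in
  (forall a i, 1 < a -> observation_model M_gt0 (S a) mu i (P a i) (obs a)) ->
  let Pmax := fun a : R =>
    (\big[maxe/0]_(i : option 'I_M) P a i (error_event M_gt0 (S a) i (obs a)))%E in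
  let EN := fun (a : R) (i : 'I_M) =>
    expected_samples M_gt0 (S a) (P a (Some i)) (obs a) in
  let EC := fun (a : R) (i : 'I_M) =>
    expected_cost M_gt0 (S a) mu (Some i) (P a (Some i)) (obs a) in
  [/\ Pmax a @[a --> +oo] --> 0%E,
      forall (a : R) (i : 'I_M), 1 < a -> EN a i = EC a i
    & exists eps : R -> R, eps a @[a --> +oo] --> 0 /\
        \forall a \near +oo, forall i : 'I_M,
          (EN a i <= - lne (Pmax a) * ((1 + eps a) / (nu * relent mu pi))%:E)%E].
Proof.
move=> pi_pmf rho1_gt1 rho2_gt1 /andP[nu_gt0 nu_lt1]; exists 1; split=> // b /andP[b_gt0 _].
move=> sched rule schedP ruleP mu mu_pmf mu_pi d T P obs S model Pmax EN EC.
have y0 : Y := pmf_inhabited pi_pmf.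
have ENE (a : R) (i : 'I_M) : 1 < a -> EN a i = EC a i.
  move=> a1; have l0 : 0 <= level (S a) by rewrite /=; lra.
  exact: (expected_samplesE y0 l0 mu_pmf pi_pmf (model a (Some i) a1)).
(* the gap between nu and 1 is split between the two asymptotic estimates *)
pose nu1 := (1 + nu) / 2; pose delta := (1 - nu) / 4.
have [d0 d1] : 0 < delta /\ delta <= 1 / 2 by rewrite /delta; split; lra.
have delta_lt1 : delta < 1 by rewrite /delta; lra.
have nu1_gt0 : 0 < nu1 by rewrite /nu1; lra.
have nu1_d : nu1 < 1 - delta by rewrite /nu1 /delta; lra.
pose s := Num.min 1 ((nu1 / nu - 1) / 16).
have ratio1 : 1 < nu1 / nu by rewrite ltr_pdivlMr // mul1r /nu1; lra.
have s0 : 0 < s by rewrite lt_min ltr01 divr_gt0 // subr_gt0.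
have s1 : s <= 1 by rewrite ge_min lexx.
have s16 : 16 * s <= nu1 / nu - 1.
  by rewrite mulrC -ler_pdivlMr // ge_min lexx orbT.
have D_gt0 := relent_gt0 mu_pmf pi_pmf mu_pi.
set D := relent mu pi in D_gt0 *.
pose xi := (D - D / (1 + s)) / 2.
have xi0 : 0 < xi.
  rewrite divr_gt0 // subr_gt0 ltr_pdivrMr; last by lra.
  by rewrite mulrDr mulr1 ltrDl mulr_gt0.
have [c [c0 r_lt1]] := chernoff_rate pi mu_pmf xi0; set r := (\sum_y _) in r_lt1.
have r_ge0 : 0 <= r.
  by apply: sumr_ge0 => y _; rewrite mulr_ge0 ?expR_ge0 // ltW // mu_pmf.1.
have [B [k1 [B1 visits]]] := exploration_visits Y M_gt0 b_gt0.
have C0 : 0 <= cost_cst M b B k1 by apply: cost_cst_ge0.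
set C := cost_cst M b B k1 in C0.
pose t a := outer_threshold rho1 rho2 a.
have bounds : \forall a \near +oo_R,
    (Pmax a <= (expR (- (nu1 * t a)))%:E)%E /\
    forall i, (EN a i <= (nu1 / nu * (t a / D))%:E)%E.
  near=> a.
  have a2 : 2 < a by near: a; apply: near_gt.
  have a0 : 0 < a by lra.
  have a1 : 1 < a by lra.
  have am1 : 1 < a - 1 by lra.
  have eps_small : 16 * B%:R ^+ 2 * inner_error delta a <= 1.
    by near: a; apply: near_inner_error_small => //; rewrite mulr_ge0 // exprn_ge0.
  have eps_C : C / s * inner_error delta a <= 1.
    by near: a; apply: near_inner_error_small => //; rewrite divr_ge0 // ltW.
  have [eps_large _] : 12 / a <= inner_error delta a /\ 1 <= inner_error delta a * a.
    by near: a; apply: near_inner_error_large.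
  have [N0 [N0_gt0 N0L N0thr N0c]] : exists N0 : nat, [/\ (0 < N0)%N,
      (N0 <= Num.truncn (inner_horizon rho1 a))%N,
      forall m, (N0 <= m)%N ->
        ln a + m%:R `^ (2 / 3) + #|Y|%:R * ln (m%:R + 1) <= m%:R * (D - xi) &
      N0%:R + (1 - r)^-1 <= (1 + s) ^+ 2 * (ln a / D)].
    by near: a; apply: near_detection_start.
  have missed : 1 - inner_alarm_prob y0 pi rho1 a mu <= inner_error delta a.
    apply: le_trans (missed_detection_le mu_pmf pi_pmf y0 (ltW a0) c0 N0_gt0 N0thr N0L) _.
    by near: a; apply: near_geometric_horizon.
  have l1 : 1 <= ln a by near: a; apply: near_ln.
  have t_ge0 : 0 <= t a by rewrite mulr_ge0 ?powR_ge0.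
  have visits_a := visits (S a) schedP.
  split.
    apply: bigmax_le => [|i _]; first by rewrite lee_fin expR_ge0.
    apply: le_trans (error_le pi_pmf mu_pmf delta_lt1 a2 ruleP B1 visits_a
      eps_small eps_large missed (model a i a1)) _.
    have tM : ln M%:R / (1 - delta - nu1) <= t a.
      by near: a; apply: near_outer_threshold.
    have M0 : 0 < M%:R :> R by rewrite ltr0n.
    rewrite lee_fin -[X in X * _](lnK M0) -expRD ler_expR.
    move: tM; rewrite ler_pdivrMr ?subr_gt0 // => tM; rewrite -/(t a) lerBlDr.
    by apply: le_trans tM _; rewrite [leRHS](_ : _ = t a * (1 - delta - nu1)) //; ring.
  move=> i; rewrite ENE //.
  apply: le_trans (cost_le pi_pmf mu_pmf b_gt0 a2 schedP ruleP B1 visits_a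
      eps_small eps_large missed (model a (Some i) a1)) _.
  rewrite lee_fin -/C -/(t a).
  have K_le : 1 + t a / ln (a - 1) <= (1 + s) * (t a / ln a).
    by near: a; apply: near_margin_le.
  have wait : (Num.truncn (inner_horizon rho1 a))%:R *
      (C + ln (t a / ln (a - 1) + 1) / b) <= s / D * t a.
    by near: a; apply: near_wait_le => //; rewrite divr_gt0.
  have det : inner_mean pi rho1 a mu <= (1 + s) ^+ 2 * (ln a / D).
    apply: le_trans N0c.
    exact: (detection_time_le mu_pmf pi_pmf y0 rho1 (ltW a0) c0 r_lt1 N0_gt0 N0thr).
  have lnm : 0 < ln (a - 1) by apply: ln_gt0.
  have eC : 1 + C * inner_error delta a <= 1 + s.
    by rewrite lerD2l; move: eps_C; rewrite mulrAC ler_pdivrMr // mul1r.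
  have main : inner_mean pi rho1 a mu *
      ((1 + t a / ln (a - 1)) * (1 + C * inner_error delta a)) <= (1 + s) ^+ 4 * (t a / D).
    have e0 := ltW (inner_error_gt0 delta a).
    have K0 : 0 <= 1 + t a / ln (a - 1) by rewrite addr_ge0 // divr_ge0 // ltW.
    have E0 : 0 <= 1 + C * inner_error delta a by rewrite addr_ge0 // mulr_ge0.
    have c_ge0 : 0 <= inner_mean pi rho1 a mu.
      apply: (inner_mean_ge0 y0 _ _ (ltW a0)) => [y|]; last exact: mu_pmf.2.
      by rewrite ltW // mu_pmf.1.
    apply: (@le_trans _ _ ((1 + s) ^+ 2 * (ln a / D) * ((1 + s) * (t a / ln a) * (1 + s)))).
      by apply: ler_pM => //; [apply: mulr_ge0|apply: ler_pM].
    rewrite slack_product //; exact: lt_le_trans l1.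
  apply: le_trans (lerD main wait) _.
  rewrite [s / D * _]mulrAC -[s * _ / _]mulrA -mulrDl ler_wpM2r ?divr_ge0 ?(ltW D_gt0) //.
  apply: le_trans (lerD (slack_power (ltW s0) s1) (lexx s)) _.
  have -> : 1 + 15 * s + s = 16 * s + 1 by ring.
  by rewrite -lerBrDr.
have Pmax_ge0 a : (0 <= Pmax a)%E by apply: bigmax_ge_id.
split=> //.
  apply/fine_cvgP; split.
    near=> a; have [Pa _] : (Pmax a <= (expR (- (nu1 * t a)))%:E)%E /\
      forall i, (EN a i <= (nu1 / nu * (t a / D))%:E)%E by near: a.
    by rewrite ge0_fin_numE // (le_lt_trans Pa) // ltry.
  apply/cvgr0Pnorm_le => e e0; near=> a.
  have [Pa _] : (Pmax a <= (expR (- (nu1 * t a)))%:E)%E /\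
    forall i, (EN a i <= (nu1 / nu * (t a / D))%:E)%E by near: a.
  have te : - ln e / nu1 <= t a by near: a; apply: near_outer_threshold.
  rewrite /= ger0_norm ?fine_ge0 //.
  have Pfin : Pmax a \is a fin_num by rewrite ge0_fin_numE // (le_lt_trans Pa) // ltry.
  rewrite -lee_fin fineK //; apply: le_trans Pa _.
  rewrite lee_fin -[leRHS](lnK e0) ler_expR lerNl.
  by move: te; rewrite ler_pdivrMr // mulrC.
(* the factor nu1 / nu > 1 has absorbed the relative error *)
exists (fun=> 0); split; first exact: cvg_cst.
near=> a => i.
have [Pa ENa] : (Pmax a <= (expR (- (nu1 * t a)))%:E)%E /\
  forall i, (EN a i <= (nu1 / nu * (t a / D))%:E)%E by near: a.
apply: le_trans (ENa i) _; rewrite addr0.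
have lnP : ((nu1 * t a)%:E <= - lne (Pmax a))%E.
  rewrite leeNr -EFinN -[(- _)%R in leRHS]expRK -lne_EFin ?expR_gt0 //.
  by rewrite lee_lne // in_itv /= ?leey ?andbT // lee_fin expR_ge0.
have c_ge0 : (0 <= (1 / (nu * D))%:E)%E by rewrite lee_fin divr_ge0 // mulr_ge0 // ltW.
apply: le_trans (lee_wpmul2r c_ge0 lnP); rewrite -EFinM lee_fin.
rewrite le_eqVlt; apply/orP; left; apply/eqP.
by field; rewrite !gt_eqF.
Unshelve. all: by end_near. Qed.
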